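(* Let $\rho=\rho_{AB}$ be any state of a finite-dimensional bipartite quantum system $AB$ with minimal local dimension $d:=\min\{|A|,|B|\}\geq 2$, and let $p\in\mathbb{N}^+$ be any positive integer. Then $$E_{\chi,p}(\rho)\ \leq\ E_{c,\mathrm{PPT}}^{\mathrm{exact}}(\rho)\ \leq\ E_{\kappa,p}(\rho)\ \leq\ E_{\chi,p}(\rho)+\log_2\frac{1}{1-\left(1-\frac{2}{d}\right)^p}\,.$$ In particular, $$E_{c,\mathrm{PPT}}^{\mathrm{exact}}(\rho)=E_\kappa^\infty(\rho)=\lim_{p\to\infty}E_{\chi,p}(\rho)=\lim_{p\to\infty}E_{\kappa,p}(\rho)\,,$$ with the convergence in $p$ being exponentially fast uniformly in $\rho$.
   Context: All Hilbert spaces are finite-dimensional and complex; $|A|$ is the dimension of $\mathcal{H}_A$. A state on $AB$ is a positive semi-definite unit-trace operator on $\mathcal{H}_A\otimes\mathcal{H}_B$. $X\leq Y$ means $Y-X$ is positive semi-definite. $\Gamma$ is the partial transpose on the second party: the linear map with $(X_A\otimes Y_B)^\Gamma=X_A\otimes Y_B^{\intercal}$ (transpose in a fixed basis). $\rho^{\otimes n}$ is regarded as a bipartite state with parties $A^n$ and $B^n$. For $p\in\mathbb{N}=\{0,1,2,\ldots\}$: $E_{\chi,p}(\rho):=\log_2\chi_p(\rho)$, where $$\chi_p(\rho):=\min\{\mathrm{Tr}\,S_p:\ -S_i\leq S_{i-1}^\Gamma\leq S_i,\ i=0,\ldots,p,\ S_{-1}=\rho\},$$ the minimum being over Hermitian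 operators $S_0,\ldots,S_p$ on $\mathcal{H}_A\otimes\mathcal{H}_B$. For $q\in\mathbb{N}^+=\{1,2,\ldots\}$: $E_{\kappa,q}(\rho):=\log_2\kappa_q(\rho)$, where $$\kappa_q(\rho):=\min\{\mathrm{Tr}\,S_{q-1}:\ -S_i\leq S_{i-1}^\Gamma\leq S_i,\ i=0,\ldots,q-1,\ S_{-1}=\rho,\ S_{q-1}^\Gamma\geq 0\},$$ over Hermitian $S_0,\ldots,S_{q-1}$. Set $E_\kappa:=E_{\kappa,1}$, i.e. $E_\kappa(\rho)=\log_2\min\{\mathrm{Tr}\,S:\ -S\leq\rho^\Gamma\leq S,\ S^\Gamma\geq 0\}$, and $E_\kappa^\infty(\rho):=\lim_{n\to\infty}\frac1n E_\kappa(\rho^{\otimes n})$. A completely positive map $\Lambda$ from operators on $AB$ to operators on $A'B'$ is PPT if $\Gamma_{B'}\circ\Lambda\circ\Gamma_B$ is also completely positive; a PPT channel is a trace-preserving PPT map. With $\Phi_2=|\Phi_2\rangle\langle\Phi_2|$, $|\Phi_2\rangle=\frac{1}{\sqrt2}(|00\rangle+|11\rangle)$, the zero-error PPT entanglement cost is $$E_{c,\mathrm{PPT}}^{\mathrm{exact}}(\rho):=\inf\{R:\ \text{for all sufficiently large } n\in\mathbb{N}\ \exists\text{ a PPT channel }\Lambda_n\text{ with }\Lambda_n(\Phi_2^{\otimes\lfloor Rn\rfloor})=\rho^{\otimes n}\}.$$ *)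

(* Defs.v *)
From HB Require Import structures.
From mathcomp Require Import all_boot all_order all_algebra.
From mathcomp Require Import spectral sesquilinear.
From mathcomp Require Import complex mxtens.
From mathcomp Require Import all_classical all_reals all_analysis.

Set Implicit Arguments.
Unset Strict Implicit.
Unset Printing Implicit Defensive.

Import Order.TTheory GRing.Theory Num.Theory.
Import numFieldNormedType.Exports.

Local Open Scope classical_set_scope.
Local Open Scope ring_scope.
Local Open Scope sesquilinear_scope.
Local Open Scope complex_scope.

Section Operators.
Variable R : realType.
Local Notation C := R[i].

(* In R[i], 0 <= z says that z is real and nonnegative; hence a matrix
   satisfying this condition is automatically Hermitian. *)
Definition psdmx n (A : 'M[C]_n) : Prop :=
  forall v : 'cV[C]_n, 0 <= (v ^t* *m A *m v) 0 0.

Definition loewner n (X Y : 'M[C]_n) : Prop := psdmx (Y - X).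

Definition is_state n (rho : 'M[C]_n) : Prop := psdmx rho /\ \tr rho = 1.

(* (id_k (x) L)(X), blockwise: X is a k x k block matrix with m x m blocks. *)
Definition ampliation k m n (L : 'M[C]_m -> 'M[C]_n) (X : 'M[C]_(k * m)) :
    'M[C]_(k * n) :=
  \matrix_(u, v)
    L (\matrix_(s, t) X (mxtens_index ((mxtens_unindex u).1, s))
                        (mxtens_index ((mxtens_unindex v).1, t)))
      (mxtens_unindex u).2 (mxtens_unindex v).2.

Definition completely_positive m n (L : 'M[C]_m -> 'M[C]_n) : Prop :=
  forall k (X : 'M[C]_(k * m)), psdmx X -> psdmx (ampliation L X).

End Operators.

(* An operator on H_A (x) H_B, |A| = a and |B| = b, is a matrix of size a * b;
   the basis vector |i>|j> has index mxtens_index (i, j), so that X (x) Y is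
   the Kronecker product X *t Y. *)
Section Bipartite.
Variable R : realType.
Local Notation C := R[i].

Definition ptrans a b (X : 'M[C]_(a * b)) : 'M[C]_(a * b) :=
  \matrix_(u, v)
    X (mxtens_index ((mxtens_unindex u).1, (mxtens_unindex v).2))
      (mxtens_index ((mxtens_unindex v).1, (mxtens_unindex u).2)).

Lemma ptrans_tens a b (X : 'M[C]_a) (Y : 'M[C]_b) :
  ptrans (tensmx X Y) = tensmx X Y^T.
Proof. by apply/matrixP => u v; rewrite !mxE !mxtens_indexK. Qed.

(* The tensor product of an operator on AB with an operator on A'B', as an
   operator with parties AA' and BB'. *)
Definition bitens a b a' b' (X : 'M[C]_(a * b)) (Y : 'M[C]_(a' * b')) :
    'M[C]_((a * a') * (b * b')) :=
  \matrix_(u, v)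
    let i := mxtens_unindex (mxtens_unindex u).1 in
    let j := mxtens_unindex (mxtens_unindex u).2 in
    let k := mxtens_unindex (mxtens_unindex v).1 in
    let l := mxtens_unindex (mxtens_unindex v).2 in
    X (mxtens_index (i.1, j.1)) (mxtens_index (k.1, l.1)) *
    Y (mxtens_index (i.2, j.2)) (mxtens_index (k.2, l.2)).

Lemma bitens_tens a b a' b' (X : 'M[C]_a) (Y : 'M[C]_b)
    (X' : 'M[C]_a') (Y' : 'M[C]_b') :
  bitens (tensmx X Y) (tensmx X' Y') =
  tensmx (tensmx X X') (tensmx Y Y').
Proof.
by apply/matrixP => u v; rewrite mxE; cbv zeta; rewrite !mxE !mxtens_indexK mulrACA.
Qed.

(* a ^ n, in a form for which powdim a n.+1 is convertible to
   a * powdim a n. *)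
Definition powdim (a n : nat) : nat := iter n (muln a) 1%N.

Lemma powdimE a n : powdim a n = (a ^ n)%N.
Proof. by elim: n => //= n IHn; rewrite expnS -IHn. Qed.

Fixpoint bipow a b (X : 'M[C]_(a * b)) n :
    'M[C]_(powdim a n * powdim b n) :=
  if n is m.+1 then bitens X (bipow X m) else 1%:M.

Definition PPT_channel a b a' b'
    (L : 'M[C]_(a * b) -> 'M[C]_(a' * b')) : Prop :=
  [/\ completely_positive L,
      completely_positive (fun X => ptrans (L (ptrans X)))
    & forall X, \tr (L X) = \tr X].

Definition ket2 (i j : 'I_2) : 'cV[C]_(2 * 2) :=
  delta_mx (mxtens_index (i, j)) 0.

Definition ketPhi2 : 'cV[C]_(2 * 2) :=
  (sqrtC 2)^-1 *: (ket2 0 0 + ket2 1 1).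

Definition Phi2 : 'M[C]_(2 * 2) := ketPhi2 *m ketPhi2 ^t*.

End Bipartite.

Section Monotones.
Variables (R : realType) (a b : nat).
Local Notation C := R[i].
Implicit Types (rho : 'M[C]_(a * b)) (S : nat -> 'M[C]_(a * b)).

Definition log2 (x : R) : R := ln x / ln 2.

(* S_{i-1}, with S_{-1} = rho. *)
Definition prev_op rho S (i : nat) : 'M[C]_(a * b) :=
  if i is j.+1 then S j else rho.

(* The constraints for i = 0, ..., m - 1; only S_0, ..., S_{m-1} matter. *)
Definition chain rho S (m : nat) : Prop :=
  forall i, (i < m)%N ->
    [/\ S i \is hermsymmx, loewner (- S i) (ptrans (prev_op rho S i))
      & loewner (ptrans (prev_op rho S i)) (S i)].

(* The minima are written as infima; both feasible sets are nonempty and the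
   infima are attained. The traces are real, as the S_i are Hermitian. *)
Definition chi (p : nat) rho : R :=
  inf [set t | exists2 S, chain rho S p.+1 & t = complex.Re (\tr (S p))].

(* Meant for 0 < q only. *)
Definition kappa (q : nat) rho : R :=
  inf [set t | exists2 S, chain rho S q /\ psdmx (ptrans (S q.-1))
                        & t = complex.Re (\tr (S q.-1))].

Definition E_chi (p : nat) rho : R := log2 (chi p rho).

Definition E_kappa (q : nat) rho : R := log2 (kappa q rho).

End Monotones.

Section Asymptotic.
Variables (R : realType) (a b : nat).
Local Notation C := R[i].
Implicit Types rho : 'M[C]_(a * b).

Definition E_kappa_rate rho (n : nat) : R :=
  n%:R^-1 * E_kappa 1 (bipow rho n).

Definition E_kappa_reg rho : R := limn (E_kappa_rate rho).

Definition achievable rho (r : R) : Prop :=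
  \forall n \near \oo,
    let m := Num.truncn (r * n%:R) in
    exists2 L : {linear 'M[C]_(powdim 2 m * powdim 2 m) ->
                        'M[C]_(powdim a n * powdim b n)},
      PPT_channel L & L (bipow (Phi2 R) m) = bipow rho n.

(* Rates are nonnegative, for which Num.truncn is the floor. The infimum is
   taken in the extended reals, so that it would be +oo if no rate were
   achievable. *)
Definition E_c_PPT_exact rho : \bar R :=
  ereal_inf [set r%:E | r in [set r : R | 0 <= r /\ achievable rho r]].

End Asymptotic.

(* Main.v *)
(* Lower bound.  A PPT channel maps a chain for its input to a chain for its
   output with the same traces, and Phi_2^(x)m has the constant chain 2^-m 1 of
   trace 2^m.  Moreover chi_p is supermultiplicative: by Hahn-Banach, chi_p(rho)
   is Tr(W_0 rho^Gamma) for a dual chain -W_(i+1)^Gamma <= W_i <= W_(i+1)^Gamma with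
   W_(p+1) = 1, and tensor powers of dual chains are dual chains.

   Upper bound.  Measuring Phi_2^(x)m and preparing rho or the state S^Gamma/Tr S
   is a PPT channel as soon as Tr S <= 2^m - 1, S being feasible for kappa_1.  A
   chain for kappa_q yields S = S_0 + S_1^Gamma + S_2 + ... feasible for kappa_1,
   so that kappa_1 <= q kappa_q; since kappa_q is submultiplicative, the factor q
   disappears in the rate.

   Comparison.  If N = (S_p - S_(p-1)^Gamma)/2, then adding to S_(p-1) the operator
   Z = d/(d+1) (N_A (x) 1 + N^Gamma) makes its partial transpose positive, at the
   cost Tr Z = d Tr N.  This gives chi_p >= (2/d) kappa_p + (1 - 2/d) chi_(p-1),
   hence kappa_p - chi_p <= (1 - 2/d)^p kappa_p. *)
Require Import Defs.
From HB Require Import structures.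
From mathcomp Require Import all_boot all_order all_algebra.
From mathcomp Require Import spectral sesquilinear.
From mathcomp Require Import complex mxtens.
From mathcomp Require Import ring lra.
From mathcomp Require Import all_classical all_reals all_analysis.

Import Order.TTheory GRing.Theory Num.Theory.
Import numFieldNormedType.Exports.

Local Open Scope classical_set_scope.
Local Open Scope ring_scope.
Local Open Scope complex_scope.

Set Implicit Arguments.
Unset Strict Implicit.
Unset Printing Implicit Defensive.
Local Open Scope sesquilinear_scope.
Local Open Scope ring_scope.

(** Tensor powers of feasible chains bound a value from above only, so the lower bound on the cost
    has to pass through the dual programme. A dual optimum is found by perturbing every constraint:
    multiples of the identity are feasible for any Hermitian perturbation, so the optimal value is a
    finite sublinear function on a finite-dimensional real space, and a linear functional that
    touches it from below at the original data is the dual chain.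

    In the protocol, the partially transposed channel sees Phi^Gamma, which is 2^-m times a swap. It
    is therefore again a measurement followed by a preparation, now for the symmetric and
    antisymmetric subspaces, and the -1 in 2^m - 1 is what positivity on the symmetric outcome
    costs.

    The regularized E_kappa obeys the same two bounds as the cost, up to a term log q / n, so one
    sandwich yields both the convergence in n and the common value. *)

(** * Conjugate transposes, Hermitian matrices and their diagonalization *)

Section ConjugateTranspose.
Variable C : numClosedFieldType.

Lemma trmxC_mul m n p (A : 'M[C]_(m, n)) (B : 'M[C]_(n, p)) :
  (A *m B)^t* = B^t* *m A^t*.
Proof. by rewrite trmx_mul map_mxM. Qed.

Lemma trmxCD m n (A B : 'M[C]_(m, n)) : (A + B)^t* = A^t* + B^t*.
Proof. by rewrite linearD map_mxD. Qed.

Lemma trmxCB m n (A B : 'M[C]_(m, n)) : (A - B)^t* = A^t* - B^t*.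
Proof. by rewrite linearB map_mxB. Qed.

Lemma trmxCN m n (A : 'M[C]_(m, n)) : (- A)^t* = - A^t*.
Proof. by rewrite linearN map_mxN. Qed.

Lemma trmxCZ m n c (A : 'M[C]_(m, n)) : (c *: A)^t* = c^* *: A^t*.
Proof. by rewrite linearZ map_mxZ. Qed.

Lemma trmxC1 n : (1%:M : 'M[C]_n)^t* = 1%:M.
Proof. by rewrite trmx1 map_mx1. Qed.

Lemma trmxC_delta m n i j : (delta_mx i j : 'M[C]_(m, n))^t* = delta_mx j i.
Proof. by rewrite trmx_delta map_delta_mx. Qed.

Lemma hermsymP n (A : 'M[C]_n) : reflect (A^t* = A) (A \is hermsymmx).
Proof.
apply: (iffP (is_hermitianmxP _ _ _)); rewrite expr0 scale1r.
  by move=> {2}->.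
by move=> ->.
Qed.

(** Polarization: reality of the form at u + v gives the sum, and at iu + v the difference, of the
    two relations wanted between f u v and f v u. *)
Lemma real_form_herm n (A : 'M[C]_n) :
  (forall v : 'cV[C]_n, (v^t* *m A *m v) 0 0 \is Num.real) -> A^t* = A.
Proof.
move=> rA.
pose f (u v : 'cV[C]_n) := (u^t* *m A *m v) 0 0.
have fE u v : (f u v)^* = f v u.
  have fDD x y : f (x + y) (x + y) = f x x + f y y + (f x y + f y x).
    by rewrite /f trmxCD !mulmxDr !mulmxDl !mxE; ring.
  have fZl c x y : f (c *: x) y = c^* * f x y.
    by rewrite /f trmxCZ -!scalemxAl mxE.
  have fZr c x y : f x (c *: y) = c * f x y.
    by rewrite /f -!scalemxAr mxE.
  have re x : (f x x)^* = f x x by apply/CrealP/rA.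
  have cross x y : (f x y)^* + (f y x)^* = f x y + f y x.
    by have := re (x + y); rewrite fDD !rmorphD /= !re => /addrI.
  have h1 := cross u v; have := cross ('i *: u) v.
  rewrite fZl fZr !rmorphM /= conjCK conjCi => h2.
  have {}h2 : (f u v)^* - (f v u)^* = - f u v + f v u.
    apply: (mulfI (neq0Ci C)); move: h2.
    by rewrite !mulNr mulrBr mulrDr mulrN => ->.
  have : 2 * (f u v)^* = 2 * f v u.
    by have := congr2 +%R h1 h2; rewrite !mulr_natl !mulr2n addrACA addrN addr0
      => ->; rewrite addrACA addrN add0r.
  by apply: mulfI; rewrite pnatr_eq0.
apply/matrixP => i j; rewrite !mxE.
have fij k l : f (delta_mx k 0) (delta_mx l 0) = A k l.
  by rewrite /f trmxC_delta -rowE -colE !mxE.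
by rewrite -!fij fE.
Qed.

Lemma herm_spectral n (A : 'M[C]_n) : A^t* = A ->
  exists (U : 'M[C]_n) (d : 'rV[C]_n), [/\ U *m U^t* = 1%:M,
    forall i, d 0 i \is Num.real & A = U^t* *m diag_mx d *m U].
Proof.
move=> hA; have hA' : A \is hermsymmx by apply/hermsymP.
have := hermitian_normalmx hA' => /orthomx_spectralP AE.
have Uu := spectral_unitarymx A.
exists (spectralmx A), (spectral_diag A); split.
- exact/unitarymxP.
- by move=> i; have /mxOverP := hermitian_spectral_diag_real hA'; apply.
- by rewrite -(invmx_unitary Uu).
Qed.

Lemma diag_sqrt_gram n (d : 'rV[C]_n) : (forall i, 0 <= d 0 i) ->
  diag_mx d = (diag_mx (map_mx sqrtC d))^t* *m diag_mx (map_mx sqrtC d).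
Proof.
move=> d0; rewrite tr_diag_mx map_diag_mx mulmx_diag; congr diag_mx.
apply/rowP => i; rewrite !mxE /=.
have /CrealP -> : sqrtC (d 0 i) \is Num.real by rewrite ger0_real // sqrtC_ge0.
by rewrite -expr2 sqrtCK.
Qed.

End ConjugateTranspose.

(** * Positive semi-definite matrices *)

Section Psd.
Variable R : realType.
Local Notation C := R[i].

Lemma psdmxD n (A B : 'M[C]_n) : psdmx A -> psdmx B -> psdmx (A + B).
Proof.
by move=> pA pB v; rewrite mulmxDr mulmxDl mxE addr_ge0 ?pA ?pB.
Qed.

Lemma psdmxZ n c (A : 'M[C]_n) : 0 <= c -> psdmx A -> psdmx (c *: A).
Proof.
by move=> c0 pA v; rewrite -scalemxAr -scalemxAl mxE mulr_ge0 ?pA.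
Qed.

Lemma psdmx0 n : psdmx (0 : 'M[C]_n).
Proof. by move=> v; rewrite mulmx0 mul0mx mxE. Qed.

Lemma psdmx_sum n I (r : seq I) (P : pred I) (F : I -> 'M[C]_n) :
  (forall i, P i -> psdmx (F i)) -> psdmx (\sum_(i <- r | P i) F i).
Proof.
by move=> pF; apply: big_ind; [exact: psdmx0|move=> A B; exact: psdmxD|exact: pF].
Qed.

Lemma psdmx_conj m n (K : 'M[C]_(n, m)) (A : 'M[C]_n) :
  psdmx A -> psdmx (K^t* *m A *m K).
Proof.
by move=> pA v; have := pA (K *m v); rewrite trmxC_mul !mulmxA.
Qed.

Lemma psdmx1 n : psdmx (1%:M : 'M[C]_n).
Proof.
move=> v; rewrite mulmx1 mxE; apply: sumr_ge0 => i _.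
by rewrite !mxE mulrC mul_conjC_ge0.
Qed.

Lemma psdmx_gram m n (K : 'M[C]_(m, n)) : psdmx (K^t* *m K).
Proof. by have := psdmx_conj K (@psdmx1 m); rewrite mulmx1. Qed.

Lemma psdmx_herm n (A : 'M[C]_n) : psdmx A -> A^t* = A.
Proof. by move=> pA; apply: real_form_herm => v; apply: ger0_real; exact: pA. Qed.

Lemma psdmx_diag n (d : 'rV[C]_n) : (forall i, 0 <= d 0 i) -> psdmx (diag_mx d).
Proof.
move=> d0 v; rewrite -mulmxA mul_diag_mx mxE; apply: sumr_ge0 => i _.
by rewrite !mxE mulrCA mulr_ge0 // mulrC mul_conjC_ge0.
Qed.

Lemma psdmx_sqrt n (A : 'M[C]_n) : psdmx A -> exists K : 'M[C]_n, A = K^t* *m K.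
Proof.
move=> pA; have [U [d [UU _ AE]]] := herm_spectral (psdmx_herm pA).
have d0 i : 0 <= d 0 i.
  have := psdmx_conj (U^t*) pA; rewrite trmxCK AE !mulmxA UU mul1mx.
  rewrite -mulmxA UU mulmx1 => /(_ (delta_mx i 0)).
  by rewrite trmxC_delta -mulmxA -colE -rowE !mxE eqxx mulr1n.
exists (diag_mx (map_mx sqrtC d) *m U).
by rewrite {1}AE (diag_sqrt_gram d0) trmxC_mul !mulmxA.
Qed.

Lemma mxtrace_ge0 n (A : 'M[C]_n) : psdmx A -> 0 <= \tr A.
Proof.
move=> pA; apply: sumr_ge0 => i _; have := pA (delta_mx i 0).
by rewrite trmxC_delta -mulmxA -colE -rowE !mxE.
Qed.

Lemma mxtraceM_ge0 n (A B : 'M[C]_n) : psdmx A -> psdmx B -> 0 <= \tr (A *m B).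
Proof.
move=> pA /psdmx_sqrt[K ->]; rewrite mulmxA mxtrace_mulC mulmxA.
apply: mxtrace_ge0; rewrite -{1}[K]trmxCK; exact: psdmx_conj.
Qed.

Lemma herm_bound n (A : 'M[C]_n) : A^t* = A ->
  exists2 c : R, 0 <= c & psdmx (c%:C%:M - A) /\ psdmx (c%:C%:M + A).
Proof.
move=> /herm_spectral[U [d [UU dR AE]]].
have UU' : U^t* *m U = 1%:M by apply: mulmx1C.
(* The sum of the moduli of the eigenvalues bounds each of them, and covers n = 0 as well. *)
have c0 : 0 <= \sum_i `|d 0 i| by apply: sumr_ge0.
have /complex_realP[c cE] := ger0_real c0.
exists c; first by rewrite -ler0c -cE.
have dc i : `|d 0 i| <= c%:C by rewrite -cE (bigD1 i) //= lerDl sumr_ge0.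
have {}cE : c%:C%:M = U^t* *m diag_mx (const_mx c%:C) *m U.
  by rewrite diag_const_mx scalar_mxC -mulmxA UU' mulmx1.
rewrite cE AE -mulmxBl -mulmxBr -mulmxDl -mulmxDr -linearB -linearD /=.
split; apply: psdmx_conj; apply: psdmx_diag => i; rewrite !mxE.
  by rewrite subr_ge0; apply: le_trans (dc i); exact: real_ler_norm.
rewrite -lerBlDr sub0r; apply: le_trans (dc i).
by rewrite -normrN real_ler_norm // realN.
Qed.

(** Serves for every relabelling of a basis: the regrouping of tensor factors, and the
    identification of 1 * n with n. *)
Lemma psdmx_mxsub m n (f : 'I_m -> 'I_n) (A : 'M[C]_n) :
  psdmx A -> psdmx (mxsub f f A).
Proof.
move=> pA; pose K : 'M[C]_(n, m) := \matrix_(k, u) (k == f u)%:R.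
suff -> : mxsub f f A = K^t* *m A *m K by exact: psdmx_conj.
apply/matrixP => u v; rewrite !mxE (bigD1 (f v)) //= !mxE eqxx mulr1.
rewrite [X in _ + X]big1 => [|k /negPf nk]; last by rewrite !mxE nk mulr0.
rewrite addr0 (bigD1 (f u)) //= !mxE eqxx conjC1 mul1r.
rewrite big1 ?addr0 // => k /negPf nk; by rewrite !mxE nk conjC0 mul0r.
Qed.

Lemma psdmx_tens m n (A : 'M[C]_m) (B : 'M[C]_n) :
  psdmx A -> psdmx B -> psdmx (A *t B).
Proof.
move=> /psdmx_sqrt[K ->] /psdmx_sqrt[L ->].
suff -> : (K^t* *m K) *t (L^t* *m L) = (K *t L)^t* *m (K *t L).
  exact: psdmx_gram.
by rewrite trmx_tens map_mxT -tensmx_mul.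
Qed.

End Psd.

Section MxtensIndex.
Variables m n : nat.

Lemma mxtens_indexK1 (i : 'I_m) (j : 'I_n) :
  (mxtens_unindex (mxtens_index (i, j))).1 = i.
Proof. by rewrite mxtens_indexK. Qed.

Lemma mxtens_indexK2 (i : 'I_m) (j : 'I_n) :
  (mxtens_unindex (mxtens_index (i, j))).2 = j.
Proof. by rewrite mxtens_indexK. Qed.

Lemma pair1 (S T : Type) (x : S) (y : T) : (x, y).1 = x. Proof. by []. Qed.
Lemma pair2 (S T : Type) (x : S) (y : T) : (x, y).2 = y. Proof. by []. Qed.

Definition mxtensK := (mxtens_indexK1, mxtens_indexK2, pair1, pair2).

End MxtensIndex.

(** * Two-sided bounds in the Loewner order *)

Section Domination.
Variable R : realType.
Local Notation C := R[i].

(** The common form -S <= T <= S of the constraints on chains and on dual chains. Unlike the Loewner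
    order on Hermitian matrices, it is stable under tensor products. *)
Definition dominated n (T S : 'M[C]_n) := psdmx (S - T) /\ psdmx (S + T).

Lemma half_ge0 : (0 : C) <= 2^-1. Proof. by rewrite invr_ge0 ler0n. Qed.

Lemma psdmx_half n (A : 'M[C]_n) : psdmx (A + A) -> psdmx A.
Proof.
rewrite -mulr2n -[A *+ 2]scaler_nat => /(psdmxZ half_ge0).
by rewrite scalerA mulVf ?scale1r // pnatr_eq0.
Qed.

Lemma dominated_psd n (T S : 'M[C]_n) : dominated T S -> psdmx S.
Proof.
by move=> [h1 h2]; apply: psdmx_half; have := psdmxD h1 h2; rewrite addrACA addNr addr0.
Qed.

Lemma dominated_herm n (T S : 'M[C]_n) : dominated T S -> T^t* = T.
Proof.
move=> TS; have hS := psdmx_herm (dominated_psd TS).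
by have := psdmx_herm (proj2 TS); rewrite trmxCD hS => /addrI.
Qed.

Lemma dominatedN n (T S : 'M[C]_n) : dominated T S -> dominated (- T) S.
Proof. by move=> [h1 h2]; split; rewrite ?opprK. Qed.

Lemma dominatedD n (T T' S S' : 'M[C]_n) :
  dominated T S -> dominated T' S' -> dominated (T + T') (S + S').
Proof.
move=> [h1 h2] [h1' h2']; split; rewrite ?opprD addrACA.
  exact: psdmxD h1 h1'.
exact: psdmxD h2 h2'.
Qed.

Lemma dominatedZ n c (T S : 'M[C]_n) :
  0 <= c -> dominated T S -> dominated (c *: T) (c *: S).
Proof.
move=> c0 [h1 h2]; split; rewrite -?scalerBr -?scalerDr.
  exact: psdmxZ c0 h1.
exact: psdmxZ c0 h2.
Qed.

Lemma dominated_refl n (S : 'M[C]_n) : psdmx S -> dominated S S.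
Proof. by move=> pS; split; [rewrite subrr; exact: psdmx0|exact: (psdmxD pS pS)]. Qed.

Lemma dominated_trans n (T S S' : 'M[C]_n) :
  dominated T S -> psdmx (S' - S) -> dominated T S'.
Proof.
move=> [h1 h2] h; split.
  by have := psdmxD h h1; rewrite addrA subrK.
by have := psdmxD h h2; rewrite addrA subrK.
Qed.

(** One step of weak duality: twice the gap is Tr (Y - W)(S + T) + Tr (Y + W)(S - T), and both
    products have positive factors. *)
Lemma dominated_tr n (W Y T S : 'M[C]_n) :
  dominated W Y -> dominated T S -> \tr (W *m T) <= \tr (Y *m S).
Proof.
move=> [h1 h2] [h1' h2']; rewrite -subr_ge0.
have -> : \tr (Y *m S) - \tr (W *m T) =
    2^-1 * (\tr ((Y - W) *m (S + T)) + \tr ((Y + W) *m (S - T))); last first.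
  apply: mulr_ge0 (half_ge0) _.
  exact: addr_ge0 (mxtraceM_ge0 h1 h2') (mxtraceM_ge0 h2 h1').
rewrite !(mulmxDl, mulmxBl, mulmxDr, mulmxBr, mulNmx) !(raddfD, raddfN, raddfB) /=.
by move: (\tr _) (\tr _) (\tr _) (\tr _) => x y z t; field.
Qed.

End Domination.

(** * The partial transpose *)

Section PartialTranspose.
Variable R : realType.
Local Notation C := R[i].
Variables a b : nat.
Implicit Types X Y : 'M[C]_(a * b).

Lemma ptrans_is_linear : linear (@ptrans R a b).
Proof. by move=> c X Y; apply/matrixP => u v; rewrite !mxE. Qed.

HB.instance Definition _ :=
  GRing.isLinear.Build C 'M[C]_(a * b) 'M[C]_(a * b) *:%R (@ptrans R a b)
    ptrans_is_linear.

Lemma ptransK : involutive (@ptrans R a b).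
Proof.
move=> X; apply/matrixP => u v.
case: (mxtens_indexP u) => i j; case: (mxtens_indexP v) => k l.
by rewrite !mxE !mxtensK.
Qed.

Lemma mxtrace_ptrans X : \tr (ptrans X) = \tr X.
Proof.
by apply: eq_bigr => u _; case: (mxtens_indexP u) => i j; rewrite mxE !mxtens_indexK.
Qed.

Lemma ptrans_trmxC X : (ptrans X)^t* = ptrans (X^t*).
Proof. by apply/matrixP => u v; rewrite !mxE. Qed.

Lemma ptrans1 : ptrans (1%:M : 'M[C]_(a * b)) = 1%:M.
Proof.
apply/matrixP => u v.
case: (mxtens_indexP u) => i j; case: (mxtens_indexP v) => k l.
rewrite !mxE !mxtens_indexK /= !(can_eq (@mxtens_indexK _ _)) !xpair_eqE.
by rewrite [l == j]eq_sym.
Qed.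

Lemma mxtraceM_ptrans X Y : \tr (ptrans X *m ptrans Y) = \tr (X *m Y).
Proof.
rewrite /mxtrace; under eq_bigr do rewrite mxE.
under [RHS]eq_bigr do rewrite mxE.
rewrite !pair_bigA /=.
(* The two summation indices with their B-components exchanged; the left summand is the right one
   evaluated at this pair. *)
pose h (p : 'I_(a * b) * 'I_(a * b)) :=
  (mxtens_index ((mxtens_unindex p.1).1, (mxtens_unindex p.2).2),
   mxtens_index ((mxtens_unindex p.2).1, (mxtens_unindex p.1).2)).
have hK : involutive h.
  move=> [u v]; case: (mxtens_indexP u) => i j; case: (mxtens_indexP v) => k l.
  by rewrite /h !mxtensK.
rewrite [RHS](reindex_inj (inv_inj hK)); apply: eq_bigr => -[u v] _ /=.
by rewrite !mxE.
Qed.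

Lemma mxtraceM_ptransl X Y : \tr (ptrans X *m Y) = \tr (X *m ptrans Y).
Proof. by rewrite -[Y in LHS]ptransK mxtraceM_ptrans. Qed.

End PartialTranspose.

(** * Tensor products and powers of bipartite operators *)

Section BipartiteTensor.
Variable R : realType.
Local Notation C := R[i].

Section TwoFactors.
Variables a b a' b' : nat.
Implicit Types (X : 'M[C]_(a * b)) (Y : 'M[C]_(a' * b')).

(** Reorders A A' B B' as A B A' B'; along this bijection [bitens] is the Kronecker product. *)
Definition regroup (u : 'I_((a * a') * (b * b'))) : 'I_(a * b) * 'I_(a' * b') :=
  let i := mxtens_unindex (mxtens_unindex u).1 in
  let j := mxtens_unindex (mxtens_unindex u).2 in
  (mxtens_index (i.1, j.1), mxtens_index (i.2, j.2)).

Definition ungroup (p : 'I_(a * b) * 'I_(a' * b')) : 'I_((a * a') * (b * b')) :=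
  let i := mxtens_unindex p.1 in
  let j := mxtens_unindex p.2 in
  mxtens_index (mxtens_index (i.1, j.1), mxtens_index (i.2, j.2)).

Lemma regroupK : cancel regroup ungroup.
Proof.
move=> u; case: (mxtens_indexP u) => i j.
case: (mxtens_indexP i) => i1 i2; case: (mxtens_indexP j) => j1 j2.
by rewrite /ungroup /regroup; cbv zeta; rewrite !mxtensK.
Qed.

Lemma ungroupK : cancel ungroup regroup.
Proof.
move=> [u v]; case: (mxtens_indexP u) => i j; case: (mxtens_indexP v) => k l.
by rewrite /ungroup /regroup; cbv zeta; rewrite !mxtensK.
Qed.

Lemma bitensE X Y u v : bitens X Y u v =
  X (regroup u).1 (regroup v).1 * Y (regroup u).2 (regroup v).2.
Proof. by rewrite mxE. Qed.

Lemma psdmx_bitens X Y : psdmx X -> psdmx Y -> psdmx (bitens X Y).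
Proof.
move=> pX pY.
have := psdmx_mxsub (fun u => mxtens_index (regroup u)) (psdmx_tens pX pY).
congr psdmx; apply/matrixP => u v; rewrite bitensE !mxE.
by rewrite !mxtens_indexK.
Qed.

Lemma bitensDl X X' Y : bitens (X + X') Y = bitens X Y + bitens X' Y.
Proof. by apply/matrixP => u v; rewrite [RHS]mxE !bitensE mxE mulrDl. Qed.

Lemma bitensDr X Y Y' : bitens X (Y + Y') = bitens X Y + bitens X Y'.
Proof. by apply/matrixP => u v; rewrite [RHS]mxE !bitensE [X in _ * X]mxE mulrDr. Qed.

Lemma bitensNl X Y : bitens (- X) Y = - bitens X Y.
Proof. by apply/matrixP => u v; rewrite [RHS]mxE !bitensE mxE mulNr. Qed.

Lemma bitensNr X Y : bitens X (- Y) = - bitens X Y.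
Proof. by apply/matrixP => u v; rewrite [RHS]mxE !bitensE [X in _ * X]mxE mulrN. Qed.

Lemma bitensZ c c' X Y : bitens (c *: X) (c' *: Y) = (c * c') *: bitens X Y.
Proof.
by apply/matrixP => u v; rewrite [RHS]mxE !bitensE mxE [X in _ * X]mxE mulrACA.
Qed.

Lemma bitens1 : bitens (1%:M : 'M[C]_(a * b)) (1%:M : 'M[C]_(a' * b')) = 1%:M.
Proof.
apply/matrixP => u v; rewrite bitensE !mxE -natrM mulnb -xpair_eqE.
by rewrite -!surjective_pairing (can_eq regroupK).
Qed.

Lemma bitens_trmxC X Y : (bitens X Y)^t* = bitens (X^t*) (Y^t*).
Proof.
apply/matrixP => u v; rewrite [LHS]mxE [X in Num.conj X]mxE !bitensE rmorphM.
by rewrite !mxE.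
Qed.

Lemma ptrans_bitens X Y : ptrans (bitens X Y) = bitens (ptrans X) (ptrans Y).
Proof.
apply/matrixP => u v; rewrite mxE !bitensE !mxE /regroup; cbv zeta.
by rewrite !mxtensK.
Qed.

Lemma bitensM X X' Y Y' :
  bitens X Y *m bitens X' Y' = bitens (X *m X') (Y *m Y').
Proof.
apply/matrixP => u v; rewrite bitensE !mxE big_distrlr pair_bigA /=.
rewrite [RHS](reindex regroup) /=.
  by apply: eq_bigr => k _; rewrite !bitensE mulrACA.
exact: onW_bij (Bijective regroupK ungroupK).
Qed.

Lemma mxtrace_bitens X Y : \tr (bitens X Y) = \tr X * \tr Y.
Proof.
rewrite /mxtrace big_distrlr pair_bigA /= [RHS](reindex regroup) /=.
  by apply: eq_bigr => u _; rewrite bitensE.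
exact: onW_bij (Bijective regroupK ungroupK).
Qed.

(** Twice the difference and twice the sum of the two tensor products are sums of products of the
    positive factors X' +- X and Y' +- Y, with opposite signs for the difference and equal signs for
    the sum. *)
Lemma dominated_bitens X X' Y Y' :
  dominated X X' -> dominated Y Y' -> dominated (bitens X Y) (bitens X' Y').
Proof.
have cross (V : zmodType) (A B P Q : V) :
    A + P + (- Q - B) + (A - P + (Q - B)) = A - B + (A - B).
  rewrite addrACA [A + P + _]addrACA subrr addr0.
  by rewrite [- Q - B + _]addrACA addNr add0r addrACA.
move=> [h1 h2] [h1' h2']; split; apply: psdmx_half.
  have := psdmxD (psdmx_bitens h1 h2') (psdmx_bitens h2 h1').
  by rewrite !(bitensDl, bitensDr, bitensNl, bitensNr) cross.
have := psdmxD (psdmx_bitens h1 h1') (psdmx_bitens h2 h2').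
rewrite !(bitensDl, bitensDr, bitensNl, bitensNr).
have := cross _ (bitens X' Y') (- bitens X Y) (- bitens X' Y) (bitens X Y').
by rewrite !opprK => ->.
Qed.

End TwoFactors.

Section Powers.
Variables a b : nat.
Implicit Types X Y : 'M[C]_(a * b).

Lemma psdmx_bipow X n : psdmx X -> psdmx (bipow X n).
Proof.
move=> pX; elim: n => [|n IHn]; first exact: psdmx1.
exact: psdmx_bitens pX IHn.
Qed.

Lemma ptrans_bipow X n : ptrans (bipow X n) = bipow (ptrans X) n.
Proof.
elim: n => [|n IHn]; first exact: (@ptrans1 R 1 1).
by rewrite /= -IHn; exact: ptrans_bitens.
Qed.

Lemma bipowM X Y n : bipow X n *m bipow Y n = bipow (X *m Y) n.
Proof.
elim: n => [|n IHn]; first by rewrite /= mulmx1.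
by rewrite /= -IHn; exact: bitensM.
Qed.

Lemma bipow1 n : bipow (1%:M : 'M[C]_(a * b)) n = 1%:M.
Proof. by elim: n => //= n ->; exact: bitens1. Qed.

Lemma bipow_trmxC X n : (bipow X n)^t* = bipow (X^t*) n.
Proof.
elim: n => [|n IHn]; first exact: trmxC1.
by rewrite /= -IHn; exact: bitens_trmxC.
Qed.

Lemma bipowZ c X n : bipow (c *: X) n = c ^+ n *: bipow X n.
Proof.
elim: n => [|n IHn]; first by rewrite scale1r.
by rewrite /= IHn exprS; exact: bitensZ.
Qed.

Lemma mxtrace_bipow X n : \tr (bipow X n) = (\tr X) ^+ n.
Proof.
elim: n => [|n IHn]; first by rewrite mxtrace1.
by rewrite exprS -IHn; exact: mxtrace_bitens.
Qed.

Lemma dominated_bipow X Y n : dominated X Y -> dominated (bipow X n) (bipow Y n).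
Proof.
move=> XY; elim: n => [|n IHn]; first exact/dominated_refl/psdmx1.
exact: dominated_bitens XY IHn.
Qed.

End Powers.
End BipartiteTensor.

(** * A finite-dimensional Hahn-Banach theorem *)

Section Sublinear.
Variables (R : realType) (V : lmodType R).
Implicit Types (P Q : V -> R) (x y e : V).

Definition sublinear P :=
  (forall x y, P (x + y) <= P x + P y) /\
  (forall t x, 0 <= t -> P (t *: x) <= t * P x).

Lemma sublinear0 P : sublinear P -> P 0 = 0.
Proof.
move=> [PD PZ]; apply/eqP; rewrite eq_le.
have := PZ 0 0 (lexx _); rewrite scale0r mul0r => -> /=.
by have := PD 0 0; rewrite addr0 -lerBlDr subrr.
Qed.

Lemma sublinear_opp P x : sublinear P -> - P (- x) <= P x.
Proof.
by move=> sP; have := sP.1 x (- x); rewrite subrr sublinear0 // -lerBlDr sub0r.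
Qed.

(** For sublinear [P], a sublinear minorant that is odd along [e] and keeps the value [P e]. Letting
    t grow measures the slope of [P] in direction [e]. *)
Definition linearize P e x : R :=
  inf [set r | exists2 t, 0 <= t & r = P (x + t *: e) - t * P e].

Section Linearize.
Variables (P : V -> R) (e : V).
Hypothesis sP : sublinear P.

(** Makes the infimum genuine, since [inf] takes a default value on a set that is unbounded
    below. *)
Let lin_lb x : lbound [set r | exists2 t, 0 <= t & r = P (x + t *: e) - t * P e]
  (- P (- x)).
Proof.
move=> _ [t t0 ->].
have h1 := sP.1 (x + t *: e) (- x); rewrite addrAC subrr add0r in h1.
suff h2 : t * P e <= P (t *: e) by lra.
have [->|t_neq0] := eqVneq t 0; first by rewrite mul0r scale0r sublinear0.
have := sP.2 t^-1 (t *: e); rewrite invr_ge0 => /(_ t0).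
by rewrite scalerA mulVf // scale1r ler_pdivlMl // lt_def t_neq0.
Qed.

Let lin_le x t : 0 <= t -> linearize P e x <= P (x + t *: e) - t * P e.
Proof. by move=> t0; apply: ge_inf; [exists (- P (- x)); exact: lin_lb|exists t]. Qed.

Let lin_ge x r : (forall t, 0 <= t -> r <= P (x + t *: e) - t * P e) ->
  r <= linearize P e x.
Proof.
move=> h; apply: lb_le_inf; last by move=> _ [t t0 ->]; exact: h.
by exists (P (x + 0 *: e) - 0 * P e); exists 0.
Qed.

Lemma linearize_le x : linearize P e x <= P x.
Proof. by have := lin_le x (lexx 0); rewrite scale0r addr0 mul0r subr0. Qed.

Lemma linearize_opp : linearize P e (- e) <= - P e.
Proof.
by have := lin_le (- e) ler01; rewrite scale1r addNr mul1r sublinear0 // sub0r.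
Qed.

Lemma linearize_sublinear : sublinear (linearize P e).
Proof.
split=> [x y|t x t0].
  suff h : linearize P e (x + y) - linearize P e y <= linearize P e x by lra.
  apply: lin_ge => t t0.
  suff h : linearize P e (x + y) - (P (x + t *: e) - t * P e) <= linearize P e y.
    by lra.
  apply: lin_ge => s s0; have := lin_le (x + y) (addr_ge0 t0 s0).
  rewrite scalerDl addrACA mulrDl.
  by have := sP.1 (x + t *: e) (y + s *: e); lra.
have [->|t_neq0] := eqVneq t 0.
  rewrite scale0r mul0r; apply: le_trans (linearize_le 0) _.
  by rewrite sublinear0.
have {}t0 : 0 < t by rewrite lt_def t_neq0.
rewrite -ler_pdivrMl //; apply: lin_ge => s s0; rewrite ler_pdivrMl //.
apply: le_trans (lin_le _ (mulr_ge0 (ltW t0) s0)) _.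
rewrite -scalerA -scalerDr mulrBr mulrA lerD2r; exact: sP.2 (ltW t0).
Qed.

End Linearize.

(** Oddness along [e] survives the later steps: a sublinear Q below [linearize P e] has Q (- e) <= -
    P e <= - Q e, and the reverse inequality is subadditivity. *)
Lemma sublinear_linear_on P (l : seq V) : sublinear P ->
  exists Q, [/\ sublinear Q, forall x, Q x <= P x &
    forall e, e \in l -> Q (- e) = - Q e].
Proof.
elim: l P => [|e l IHl] P sP; first by exists P; split.
have [Q [sQ QP Ql]] := IHl _ (linearize_sublinear e sP).
exists Q; split => // [x|e']; first exact: le_trans (QP x) (linearize_le e sP x).
rewrite inE => /predU1P[->|]; last exact: Ql.
apply/eqP; rewrite eq_le; apply/andP; split; last first.
  by rewrite lerNl; exact: sublinear_opp.
apply: le_trans (QP _) _; apply: le_trans (linearize_opp e sP) _.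
by rewrite lerN2; apply: le_trans (QP e) (linearize_le e sP e).
Qed.

(* [P] is made linear along [x0] first, then along each [e i]; each step only
   decreases it, and the first one makes the value at [x0] stick. *)
Lemma hahn_banach_fin P (I : finType) (e : I -> V) (c0 : I -> R) : sublinear P ->
  exists w : I -> R,
    (forall c : I -> R, \sum_i c i * w i <= P (\sum_i c i *: e i)) /\
    P (\sum_i c0 i *: e i) <= \sum_i c0 i * w i.
Proof.
move=> sP; set x0 := \sum_i c0 i *: e i.
have [Q [sQ QP Ql]] := sublinear_linear_on (codom e) (linearize_sublinear x0 sP).
have QN i : Q (- e i) = - Q (e i) by apply: Ql; exact: codom_f.
have Qup (c : I -> R) : Q (\sum_i c i *: e i) <= \sum_i c i * Q (e i).
  apply: (big_ind2 (fun x r => Q x <= r)); first by rewrite sublinear0.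
    by move=> x r y s xr ys; apply: le_trans (sQ.1 _ _) _; exact: lerD.
  move=> i _; have [c_ge0|c_lt0] := lerP 0 (c i); first exact: sQ.2.
  by rewrite -[c i]opprK scaleNr -scalerN mulNr -mulrN -QN sQ.2 // oppr_ge0 ltW.
exists (fun i => Q (e i)); split=> [c|].
  have := Qup (fun i => - c i); under eq_bigr do rewrite scaleNr.
  under [in leRHS]eq_bigr do rewrite mulNr.
  rewrite !sumrN lerNr => h; apply: le_trans h _.
  apply: le_trans (sublinear_opp _ sQ) _.
  exact: le_trans (QP _) (linearize_le _ sP _).
apply: le_trans (Qup c0); rewrite -/x0.
apply: le_trans (sublinear_opp _ sQ); rewrite lerNr.
exact: le_trans (QP _) (linearize_opp _ sP).
Qed.

End Sublinear.

(** * Real coordinates on Hermitian matrices *)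

Section SymmetricCombination.
Variables (F : comNzRingType) (n : nat) (z z' : F).
Implicit Types A B : 'M[F]_n.

Definition sym_comb A : 'M[F]_n := z *: A + z' *: A^T.

Lemma sym_combD A B : sym_comb (A + B) = sym_comb A + sym_comb B.
Proof. by apply/matrixP => i j; rewrite !mxE; ring. Qed.

Lemma sym_combZ t A : sym_comb (t *: A) = t *: sym_comb A.
Proof. by apply/matrixP => i j; rewrite !mxE; ring. Qed.

Lemma mxtrace_sym_comb A B : \tr (sym_comb A *m sym_comb B) =
  (z * z + z' * z') * \tr (A *m B) + 2 * z * z' * \tr (A *m B^T).
Proof.
rewrite /sym_comb mulmxDl !mulmxDr -!scalemxAl -!scalemxAr !raddfD /= !mxtraceZ.
have -> : \tr (A^T *m B^T) = \tr (A *m B).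
  by rewrite -trmx_mul mxtrace_tr mxtrace_mulC.
have -> : \tr (A^T *m B) = \tr (A *m B^T).
  by rewrite -[LHS]mxtrace_tr trmx_mul trmxK mxtrace_mulC.
by ring.
Qed.

Lemma mxtrace_mul_trmx A B : \tr (A *m B^T) = \sum_i \sum_j A i j * B i j.
Proof.
by apply: eq_bigr => i _; rewrite mxE; apply: eq_bigr => j _; rewrite mxE.
Qed.

End SymmetricCombination.

Section HermCoef.
Variable F : numClosedFieldType.

(** Chosen as a z whose square is purely imaginary and with 2 |z|^2 = 1: in [mxtrace_sym_comb], with
    z' the conjugate of z, the term Tr (A B) disappears and Tr (A B^T), the Euclidean product, gets
    coefficient 1. *)
Definition herm_coef : F := (1 + 'i) / 2.

Lemma herm_coefC : herm_coef^* = (1 - 'i) / 2.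
Proof.
rewrite /herm_coef rmorphM fmorphV rmorphD /= conjCi rmorph1.
by rewrite rmorph_nat.
Qed.

Lemma herm_coef_sqr : herm_coef * herm_coef + herm_coef^* * herm_coef^* = 0.
Proof.
have ii : ('i : F) * 'i = -1 by rewrite -expr2 sqrCi.
rewrite herm_coefC /herm_coef; move: ('i : F) ii => x xx.
have -> : (1 + x) / 2 * ((1 + x) / 2) + (1 - x) / 2 * ((1 - x) / 2) =
  (1 + x * x) / 2 by field.
by rewrite xx subrr mul0r.
Qed.

Lemma herm_coef_norm : 2 * herm_coef * herm_coef^* = 1.
Proof.
have ii : ('i : F) * 'i = -1 by rewrite -expr2 sqrCi.
rewrite herm_coefC /herm_coef; move: ('i : F) ii => x xx.
have -> : 2 * ((1 + x) / 2) * ((1 - x) / 2) = (1 - x * x) / 2 by field.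
by rewrite xx; field.
Qed.

Lemma herm_coef_comb (x y : F) :
  herm_coef * (x + y) + herm_coef^* * (x - y) = x + 'i * y.
Proof. by rewrite herm_coefC /herm_coef; field. Qed.

Lemma sym_comb_trmxC n (A : 'M[F]_n) : map_mx Num.Def.conjC A = A ->
  (sym_comb herm_coef (herm_coef^*) A)^t* = sym_comb herm_coef (herm_coef^*) A.
Proof.
by move=> rA; rewrite /sym_comb trmxCD !trmxCZ conjCK trmxK -map_trmx rA addrC.
Qed.

End HermCoef.

Section HermitianCoordinates.
Variable R : realType.
Local Notation C := R[i].
Variable n : nat.
Implicit Types (A B : 'M[R]_n) (M : 'M[C]_n).

(* An R-linear isometry from real matrices onto Hermitian matrices. *)
Definition herm_of A : 'M[C]_n :=
  sym_comb (herm_coef C) ((herm_coef C)^*) (map_mx (real_complex R) A).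

(** Inverts [herm_of] on Hermitian matrices: entries x + iy and x - iy in transposed positions
    become x + y and x - y. *)
Definition real_of M : 'M[R]_n :=
  \matrix_(i, j) (complex.Re (M i j) + complex.Im (M i j)).

Lemma herm_of_trmxC A : (herm_of A)^t* = herm_of A.
Proof.
by apply: sym_comb_trmxC; apply/matrixP => i j; rewrite !mxE; exact: conjc_real.
Qed.

Lemma herm_ofD A B : herm_of (A + B) = herm_of A + herm_of B.
Proof. by rewrite /herm_of map_mxD; exact: sym_combD. Qed.

Lemma herm_ofZ t A : herm_of (t *: A) = t%:C *: herm_of A.
Proof. by rewrite /herm_of map_mxZ; exact: sym_combZ. Qed.

Lemma real_ofK M : M^t* = M -> herm_of (real_of M) = M.
Proof.
move=> hM; apply/matrixP => i j; rewrite /herm_of /sym_comb !mxE.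
have -> : M j i = (M i j)^* by rewrite -[in LHS]hM !mxE.
rewrite [RHS]complexE complexiE -herm_coef_comb.
by case: (M i j) => x y; rewrite -rmorphD -rmorphB.
Qed.

Lemma mxtrace_herm_of A B :
  \tr (herm_of A *m herm_of B) = (\sum_i \sum_j A i j * B i j)%:C.
Proof.
rewrite /herm_of mxtrace_sym_comb herm_coef_sqr mul0r add0r herm_coef_norm mul1r.
rewrite mxtrace_mul_trmx rmorph_sum; apply: eq_bigr => i _ /=.
by rewrite rmorph_sum; apply: eq_bigr => j _; rewrite !mxE rmorphM.
Qed.

End HermitianCoordinates.

(** * Perturbed chains and their optimal value *)

Section Chains.
Variables (R : realType) (a b : nat).
Local Notation C := R[i].
Local Notation M := 'M[C]_(a * b).
Implicit Types (rho : M) (S D W : nat -> M).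

Lemma chainP rho S m : chain rho S m <->
  forall i, (i < m)%N -> dominated (ptrans (prev_op rho S i)) (S i).
Proof.
split=> h i im.
  have [_ h1 h2] := h i im; split; first exact: h2.
  by rewrite addrC; move: h1; rewrite /loewner opprK.
have h1 := h i im; split.
- exact/hermsymP/psdmx_herm/(dominated_psd h1).
- by rewrite /loewner opprK addrC; case: h1.
- exact: h1.1.
Qed.

Lemma ptrans_scalar (c : C) : ptrans (c%:M : M) = c%:M.
Proof. by rewrite -[c%:M]scalemx1 linearZ /= ptrans1. Qed.

Lemma psdmx_scalar n (c : C) : 0 <= c -> psdmx (c%:M : 'M[C]_n).
Proof. by move=> c0; rewrite -[c%:M]scalemx1; exact: psdmxZ c0 (@psdmx1 R n). Qed.

Lemma psdmx_ge0_complex n (X : 'M[C]_n) : psdmx X ->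
  \tr X = (complex.Re (\tr X))%:C /\ 0 <= complex.Re (\tr X).
Proof.
move=> /mxtrace_ge0 X0; have E := RRe_real (ger0_real X0).
by split; [rewrite E|rewrite -ler0c E].
Qed.

(* The original constraints have D 0 = rho^Gamma and D i = 0 for i > 0; letting
   every [D i] vary makes the optimal value a sublinear function of [D]. *)
Definition pert_chain D S m := forall i, (i < m)%N ->
  dominated (ptrans (prev_op 0 S i) + D i) (S i).

Lemma pert_chainE rho S m : chain rho S m <->
  pert_chain (fun i => if i is 0%N then ptrans rho else 0) S m.
Proof.
rewrite chainP; split=> h i im; move: (h i im); case: i im => [|i] im /=.
- by rewrite linear0 add0r.
- by rewrite addr0.
- by rewrite linear0 add0r.
- by rewrite addr0.
Qed.

(** Scalars are fixed by the partial transpose, so c_i only has to exceed c_(i-1) by a bound on D_i.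
    This keeps the optimal value an infimum over a nonempty set for every perturbation. *)
Lemma exists_pert_chain D m : (forall i, (D i)^t* = D i) ->
  exists2 c : nat -> R, (forall i, 0 <= c i) &
    pert_chain D (fun i => (c i)%:C%:M) m.
Proof.
move=> hD.
have /choice[f fP] : forall i, exists c : R, 0 <= c /\ dominated (D i) c%:C%:M.
  by move=> i; have [c c0 h] := herm_bound (hD i); exists c.
pose c i := \sum_(k < i.+1) f k.
have c0 i : 0 <= c i by apply: sumr_ge0 => k _; have [] := fP k.
exists c => // i _.
have -> : (c i)%:C%:M = ptrans (prev_op 0 (fun i => (c i)%:C%:M) i) + (f i)%:C%:M :> M.
  rewrite /c big_ord_recr /=; case: i => [|i] /=.
    by rewrite big_ord0 add0r linear0 add0r.
  by rewrite ptrans_scalar rmorphD raddfD.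
apply: dominatedD (fP i).2; apply: dominated_refl; case: i => [|i] /=.
  by rewrite linear0; exact: psdmx0.
by rewrite ptrans_scalar; apply: psdmx_scalar; rewrite ler0c.
Qed.

Lemma exists_chain rho m : rho^t* = rho ->
  exists2 c : nat -> R, (forall i, 0 <= c i) &
    chain rho (fun i => (c i)%:C%:M) m.
Proof.
move=> hrho.
have [|c c0 h] := @exists_pert_chain (fun i => if i is 0%N then ptrans rho else 0) m.
  by case=> [|i]; [rewrite ptrans_trmxC hrho|rewrite trmx0 map_mx0].
by exists c => //; exact/pert_chainE.
Qed.

Lemma pert_chainD D D' S S' m : pert_chain D S m -> pert_chain D' S' m ->
  pert_chain (fun i => D i + D' i) (fun i => S i + S' i) m.
Proof.
move=> h h' i im.
have -> : prev_op 0 (fun k => S k + S' k) i = prev_op 0 S i + prev_op 0 S' i.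
  by case: i im => [|i] _ //=; rewrite addr0.
by rewrite linearD addrACA; exact: (dominatedD (h i im) (h' i im)).
Qed.

Lemma pert_chainZ (t : R) D S m : 0 <= t -> pert_chain D S m ->
  pert_chain (fun i => t%:C *: D i) (fun i => t%:C *: S i) m.
Proof.
rewrite -ler0c => t0 h i im.
have -> : prev_op 0 (fun k => t%:C *: S k) i = t%:C *: prev_op 0 S i.
  by case: i im => [|i] _ //=; rewrite scaler0.
by rewrite linearZ -scalerDr; exact: (dominatedZ t0 (h i im)).
Qed.

Lemma pert_chain_ext D D' S m : (forall i, (i < m)%N -> D i = D' i) ->
  pert_chain D S m -> pert_chain D' S m.
Proof. by move=> DD' h i im; rewrite -DD' //; exact: h. Qed.

Section Value.
Variable p : nat.
Local Notation V := {ffun 'I_p.+1 -> 'M[R]_(a * b)}.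
Implicit Types x y : V.

(** Above [p], [inord] falls back on the entry at 0, which chains of length [p.+1] never read. *)
Definition pert_of x (i : nat) : M := herm_of (x (inord i)).

Definition value x : R :=
  inf [set t | exists2 S, pert_chain (pert_of x) S p.+1 & t = complex.Re (\tr (S p))].

Lemma value_le x S : pert_chain (pert_of x) S p.+1 ->
  value x <= complex.Re (\tr (S p)).
Proof.
move=> h; apply: ge_inf; last by exists S.
exists 0 => _ [T hT ->]; have [] // := psdmx_ge0_complex (dominated_psd (hT p _)).
Qed.

Lemma value_ge x r :
  (forall S, pert_chain (pert_of x) S p.+1 -> r <= complex.Re (\tr (S p))) ->
  r <= value x.
Proof.
move=> h; apply: lb_le_inf; last by move=> _ [S hS ->]; exact: h.
have [|c _ hc] := @exists_pert_chain (pert_of x) p.+1.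
  by move=> i; exact: herm_of_trmxC.
by exists (complex.Re (\tr ((c p)%:C%:M : M))), (fun i => (c i)%:C%:M).
Qed.

Lemma value_sublinear : sublinear value.
Proof.
split=> [x y|t x t0].
  rewrite -lerBlDr; apply: value_ge => S hS; rewrite lerBlDr -lerBlDl.
  apply: value_ge => T hT; rewrite lerBlDl; have hST := pert_chainD hS hT.
  have : pert_chain (pert_of (x + y)) (fun i => S i + T i) p.+1.
    by apply: pert_chain_ext hST => i _; rewrite /pert_of ffunE herm_ofD.
  by move/value_le; rewrite mxtraceD; case: (\tr _) => u v; case: (\tr _).
have h S : pert_chain (pert_of x) S p.+1 -> value (t *: x) <= t * complex.Re (\tr (S p)).
  move=> /(pert_chainZ t0) hS.
  have : pert_chain (pert_of (t *: x)) (fun i => t%:C *: S i) p.+1.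
    by apply: pert_chain_ext hS => i _; rewrite /pert_of ffunE herm_ofZ.
  by move/value_le; rewrite mxtraceZ; case: (\tr _) => u v /=; rewrite mul0r subr0.
(* At t = 0 one cannot divide; the zero multiple of any feasible chain gives the bound. *)
have [t_eq0|t_neq0] := eqVneq t 0.
  have [|c _ /h] := @exists_pert_chain (pert_of x) p.+1.
    by move=> i; exact: herm_of_trmxC.
  by rewrite t_eq0 !mul0r.
have {}t0 : 0 < t by rewrite lt_def t_neq0.
rewrite -ler_pdivrMl //; apply: value_ge => S hS; rewrite ler_pdivrMl //.
exact: h.
Qed.

Lemma ffun_mx_sum x : x = \sum_(q : 'I_p.+1 * ('I_(a * b) * 'I_(a * b)))
  x q.1 q.2.1 q.2.2 *: [ffun k => if k == q.1 then delta_mx q.2.1 q.2.2 else 0].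
Proof.
apply/ffunP => k; apply/matrixP => i j; rewrite sum_ffunE summxE.
rewrite (bigD1 (k, (i, j))) //= !ffunE eqxx !mxE !eqxx mulr1.
rewrite big1 ?addr0 // => -[k' [i' j']]; rewrite !xpair_eqE => ne.
rewrite !ffunE /= !mxE; case: eqVneq ne => [->|_ _]; rewrite !mxE ?mulr0 //=.
by rewrite [i == i']eq_sym [j == j']eq_sym => /negPf->; rewrite mulr0.
Qed.

End Value.

(* A linear functional below the optimal value and equal to it at [D0]. *)
Lemma value_dual p D0 : (forall i, (D0 i)^t* = D0 i) ->
  exists W : nat -> M, (forall i, (W i)^t* = W i) /\
    (forall D S, (forall i, (D i)^t* = D i) -> pert_chain D S p.+1 ->
      \sum_(i < p.+1) \tr (W i *m D i) <= \tr (S p)) /\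
    (forall t : R, (forall S, pert_chain D0 S p.+1 -> t <= complex.Re (\tr (S p))) ->
      t%:C <= \sum_(i < p.+1) \tr (W i *m D0 i)).
Proof.
move=> hD0.
pose ofD D : {ffun 'I_p.+1 -> 'M[R]_(a * b)} := [ffun i : 'I_p.+1 => real_of (D i)].
have ofDK D i : (forall i, (D i)^t* = D i) -> (i < p.+1)%N ->
    pert_of (ofD D) i = D i.
  by move=> hD ip; rewrite /pert_of ffunE real_ofK inordK.
pose coef (x : {ffun 'I_p.+1 -> 'M[R]_(a * b)})
  (q : 'I_p.+1 * ('I_(a * b) * 'I_(a * b))) := x q.1 q.2.1 q.2.2.
have [w [w1 w2]] := hahn_banach_fin
  (fun q : 'I_p.+1 * ('I_(a * b) * 'I_(a * b)) =>
    [ffun k => if k == q.1 then delta_mx q.2.1 q.2.2 else 0])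
  (coef (ofD D0)) (value_sublinear p).
(* As [herm_of] is an isometry, the coefficients of the functional are the coordinates of the
   matrices that represent it in the trace pairing. *)
pose W i : M := herm_of (\matrix_(k, l) w (inord i, (k, l))).
have WE D : (forall i, (D i)^t* = D i) ->
    \sum_(i < p.+1) \tr (W i *m D i) = (\sum_q coef (ofD D) q * w q)%:C.
  move=> hD.
  transitivity (\sum_(k < p.+1) \sum_kl (coef (ofD D) (k, kl) * w (k, kl))%:C);
    last first.
    by rewrite pair_bigA rmorph_sum; apply: eq_bigr => -[k kl].
  apply: eq_bigr => i _; rewrite -[D i](real_ofK (hD i)) mxtrace_mulC.
  rewrite mxtrace_herm_of pair_bigA rmorph_sum; apply: eq_bigr => -[k l] _ /=.
  by rewrite /coef /= ffunE [in X in _ * X]mxE inord_val.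
exists W; split; first by move=> i; exact: herm_of_trmxC.
split=> [D S hD hS|t ht].
  have [-> _] := psdmx_ge0_complex (dominated_psd (hS p (ltnSn p))).
  rewrite WE // lecR; apply: le_trans (w1 _) _; rewrite -ffun_mx_sum.
  by apply: value_le; apply: pert_chain_ext hS => i ip; rewrite ofDK.
rewrite WE // lecR; apply: le_trans w2; rewrite -ffun_mx_sum.
apply: value_ge => S hS; apply: ht; apply: pert_chain_ext hS => i ip.
by rewrite ofDK.
Qed.

End Chains.

(** * Strong and weak duality for [chi] *)

Section Duality.
Variables (R : realType) (a b : nat).
Local Notation C := R[i].
Local Notation M := 'M[C]_(a * b).
Implicit Types (rho : M) (S W : nat -> M).

Definition dual_chain W p := W p.+1 = 1%:M /\
  forall i, (i <= p)%N -> dominated (W i) (ptrans (W i.+1)).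

Lemma mxtraceM_rank1 n (Y : 'M[C]_n) (v : 'cV[C]_n) :
  \tr (Y *m (v *m v^t*)) = (v^t* *m Y *m v) 0 0.
Proof. by rewrite mulmxA mxtrace_mulC mulmxA trace_mx11. Qed.

Lemma rank1_ge0 n (v : 'cV[C]_n) : psdmx (v *m v^t*).
Proof. by have := psdmx_gram (v^t*); rewrite trmxCK. Qed.

Lemma psdmx0_dominated n : dominated (0 : 'M[C]_n) 0.
Proof. exact/dominated_refl/psdmx0. Qed.

Lemma chi_le p rho S : chain rho S p.+1 -> chi p rho <= complex.Re (\tr (S p)).
Proof.
move=> h; apply: ge_inf; last by exists S.
exists 0 => _ [T /chainP hT ->].
by have [] // := psdmx_ge0_complex (dominated_psd (hT p _)).
Qed.

(* Testing the functional of [value_dual] on rank-one [S i], with the other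
   components zero, turns it into the operator inequalities of [dual_chain]. *)
Lemma chi_dual p rho : rho^t* = rho -> exists2 W, dual_chain W p &
  (chi p rho)%:C <= \tr (W 0%N *m ptrans rho).
Proof.
move=> hrho; pose D0 i := if i is 0%N then ptrans rho else 0.
have hD0 i : (D0 i)^t* = D0 i.
  by case: i => [|i] /=; [rewrite ptrans_trmxC hrho|rewrite trmx0 map_mx0].
have [W [hW [W1 W2]]] := value_dual p hD0.
(* The functional determines [W] up to index [p] only; the identity after it stands for the
   objective Tr S_p. *)
pose W' i := if (i <= p)%N then W i else 1%:M.
exists W'; last first.
  have : (chi p rho)%:C <= \sum_(i < p.+1) \tr (W i *m D0 i).
    by apply: W2 => S /pert_chainE; exact: chi_le.
  rewrite big_ord_recl /= big1 ?addr0 // => i _; by rewrite mulmx0 mxtrace0.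
split=> [|i ip]; first by rewrite /W' ltnn.
have key (X T : M) : dominated T X -> \tr (W' i *m T) <= \tr (W' i.+1 *m ptrans X).
  move=> TX; have hX := psdmx_herm (dominated_psd TX).
  (* With X at level i and zero elsewhere, the perturbation at level i.+1 cancels the partial
     transpose of X, so every constraint except that of level i reads 0 <= 0. *)
  pose D k := if k == i then T else if k == i.+1 then - ptrans X else 0.
  pose S k := if k == i then X else 0.
  have hD k : (D k)^t* = D k.
    rewrite /D; case: eqP => _; first exact: dominated_herm TX.
    case: eqP => _; first by rewrite trmxCN ptrans_trmxC hX.
    by rewrite trmx0 map_mx0.
  have hS : pert_chain D S p.+1.
    move=> k _; rewrite /D /S; have [->|ki] := eqVneq k i.
      have -> : prev_op 0 (fun k => if k == i then X else 0) i = 0.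
        by case: (i) => //= j; rewrite ltn_eqF.
      by rewrite linear0 add0r.
    have [->|ki1] := eqVneq k i.+1.
      by rewrite /= eqxx subrr; exact: psdmx0_dominated.
    have -> : prev_op 0 (fun k => if k == i then X else 0) k = 0.
      by case: (k) ki1 => //= j; rewrite eqSS => /negPf->.
    by rewrite linear0 addr0; exact: psdmx0_dominated.
  have := W1 D S hD hS.
  rewrite (bigD1 (Ordinal (ip : (i < p.+1)%N))) //= {1}/D eqxx /W' ip.
  (* For i < p the right-hand side comes from the perturbation at level i.+1 and the objective is 0;
     for i = p that level is absent, and the objective Tr X takes its place. *)
  have [ip'|ip'] := ltnP i p.
    rewrite (bigD1 (Ordinal (ip' : (i.+1 < p.+1)%N))) /=; last first.
      by rewrite -val_eqE /= gtn_eqF.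
    rewrite {1}/D eqxx gtn_eqF // big1 ?addr0 => [|k /andP[k1 k2]].
      by rewrite {1}/S gtn_eqF // mxtrace0 mulmxN linearN /= subr_le0.
    rewrite /D; move: k1 k2; rewrite -!val_eqE /= => /negPf-> /negPf->.
    by rewrite mulmx0 mxtrace0.
  have pi : p = i by apply/eqP; rewrite eqn_leq ip' ip.
  have -> : S p = X by rewrite /S pi eqxx.
  rewrite mul1mx mxtrace_ptrans big1 ?addr0 // => k.
  rewrite -val_eqE /= /D => /negPf->.
  by rewrite -[X in _ == X.+1]pi ltn_eqF // mulmx0 mxtrace0.
have rank1 (v : 'cV[C]_(a * b)) := dominated_refl (rank1_ge0 v).
split=> v.
  have := key _ _ (rank1 v); rewrite -mxtraceM_ptransl -subr_ge0.
  by rewrite -linearB -mulmxBl /= mxtraceM_rank1.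
have := key _ _ (dominatedN (rank1 v)); rewrite -mxtraceM_ptransl -subr_ge0.
by rewrite mulmxN linearN opprK -linearD -mulmxDl /= mxtraceM_rank1.
Qed.

(** The two chains are climbed together: Tr (W_i S_(i-1)^Gamma) <= Tr (W_(i+1)^Gamma S_i) = Tr
    (W_(i+1) S_i^Gamma), until W_(p+1) = 1. *)
Lemma weak_duality p rho S W : dual_chain W p -> chain rho S p.+1 ->
  \tr (W 0%N *m ptrans rho) <= \tr (S p).
Proof.
move=> [W1 hW] /chainP hS.
suff h i : (i <= p)%N -> \tr (W 0%N *m ptrans rho) <= \tr (ptrans (W i.+1) *m S i).
  by apply: le_trans (h p (leqnn p)) _; rewrite W1 ptrans1 mul1mx.
elim: i => [|i IHi] ip; first exact: dominated_tr (hW 0%N ip) (hS 0%N ip).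
apply: le_trans (IHi (ltnW ip)) _; rewrite mxtraceM_ptransl.
exact: dominated_tr (hW i.+1 ip) (hS i.+1 ip).
Qed.

End Duality.

(** * Supermultiplicativity of [chi] *)

Section Supermultiplicativity.
Variables (R : realType) (a b : nat).
Local Notation C := R[i].
Implicit Types rho : 'M[C]_(a * b).

Lemma dual_chain_bipow (W : nat -> 'M[C]_(a * b)) p n :
  dual_chain W p -> dual_chain (fun i => bipow (W i) n) p.
Proof.
move=> [W1 hW]; split=> [|i ip]; first by rewrite W1; exact: bipow1.
by rewrite ptrans_bipow; exact: dominated_bipow n (hW i ip).
Qed.

Lemma chi_ge0 p rho : 0 <= chi p rho.
Proof.
(* [rho] is arbitrary here: if it is not Hermitian there is no chain, and [inf] of the empty set is
   0. *)
rewrite /chi; set A := [set t | _]; have [->|A0] := eqVneq A set0.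
  by rewrite inf0.
apply: lb_le_inf; first exact/set0P.
move=> _ [S /chainP hS ->].
by have [] // := psdmx_ge0_complex (dominated_psd (hS p _)).
Qed.

Lemma chi_bipow p rho n S : rho^t* = rho -> chain (bipow rho n) S p.+1 ->
  chi p rho ^+ n <= complex.Re (\tr (S p)).
Proof.
move=> hrho hS; have [W hW W0] := chi_dual p hrho.
have := weak_duality (dual_chain_bipow n hW) hS.
rewrite ptrans_bipow bipowM mxtrace_bipow.
have [-> _] := psdmx_ge0_complex (dominated_psd ((chainP _ _ _).1 hS p (ltnSn p))).
move=> h; rewrite -lecR; apply: le_trans h; rewrite rmorphXn.
have c0 : 0 <= (chi p rho)%:C by rewrite ler0c chi_ge0.
exact: lerXn2r c0 (le_trans c0 W0) W0.
Qed.

End Supermultiplicativity.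

(** * PPT channels acting on chains *)

Section PositiveMaps.
Variable R : realType.
Local Notation C := R[i].

(** The ampliation with k = 1, up to relabelling. *)
Lemma completely_positive_psd m n (L : 'M[C]_m -> 'M[C]_n) (X : 'M[C]_m) :
  completely_positive L -> psdmx X -> psdmx (L X).
Proof.
move=> cpL pX.
have := psdmx_mxsub (fun s : 'I_n => mxtens_index (ord0 : 'I_1, s))
  (cpL 1%N _ (psdmx_mxsub (fun u => (mxtens_unindex u).2) pX)).
congr psdmx; apply/matrixP => s t; rewrite !mxE !mxtensK.
by congr (L _ _ _); apply/matrixP => k l; rewrite !mxE !mxtensK.
Qed.

Lemma dominated_map m n (L : {linear 'M[C]_m -> 'M[C]_n}) (T S : 'M[C]_m) :
  (forall X, psdmx X -> psdmx (L X)) -> dominated T S -> dominated (L T) (L S).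
Proof.
move=> pL [h1 h2]; split.
  by rewrite -linearB; exact: pL _ h1.
by rewrite -linearD; exact: pL _ h2.
Qed.

Section PPTChannel.
Variables a b a' b' : nat.
Variable L : {linear 'M[C]_(a * b) -> 'M[C]_(a' * b')}.
Hypothesis pptL : PPT_channel L.

Let LG (X : 'M[C]_(a * b)) : 'M[C]_(a' * b') := ptrans (L (ptrans X)).

Let LG_is_linear : linear LG.
Proof. by move=> c X Y; rewrite /LG !linearP. Qed.

HB.instance Definition _ :=
  GRing.isLinear.Build C 'M[C]_(a * b) 'M[C]_(a' * b') *:%R LG LG_is_linear.

(** L(rho)^Gamma = LG(rho^Gamma) is bounded by LG(S_0), whose partial transpose L(S_0^Gamma) is
    bounded by L(S_1), and so on. The two positive maps alternate, which is why both must be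
    positive. *)
Lemma PPT_channel_chain rho S m : chain rho S m ->
  exists2 T, chain (L rho) T m & forall i, \tr (T i) = \tr (S i).
Proof.
have [cpL cpLG trL] := pptL.
move=> /chainP hS; exists (fun i => if odd i then L (S i) else LG (S i)); last first.
  by move=> i; case: ifP => _; rewrite ?mxtrace_ptrans trL ?mxtrace_ptrans.
have domL := dominated_map (fun X => completely_positive_psd cpL).
have domLG := dominated_map (L := LG) (fun X => completely_positive_psd cpLG).
have LGr X : LG (ptrans X) = ptrans (L X) by rewrite /LG ptransK.
have LGl X : ptrans (LG X) = L (ptrans X) by rewrite /LG ptransK.
apply/chainP => -[|i] im /=.
  by rewrite -LGr; exact: domLG _ _ (hS 0%N im).
have := hS i.+1 im; case: (odd i) => h /=.
  by rewrite -LGr; exact: domLG _ _ h.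
by rewrite LGl; exact: domL _ _ h.
Qed.

End PPTChannel.
End PositiveMaps.

(** * The maximally entangled state and its constant chain *)

Section MaximallyEntangled.
Variable R : realType.
Local Notation C := R[i].

Lemma Phi2E (i j k l : 'I_2) :
  Phi2 R (mxtens_index (i, j)) (mxtens_index (k, l)) = 2^-1 * ((i == j) && (k == l))%:R.
Proof.
have wE (u v : 'I_2) : (ket2 R 0 0 + ket2 R 1 1) (mxtens_index (u, v)) 0 = (u == v)%:R.
  rewrite !mxE /= !(can_eq (@mxtens_indexK _ _)) !xpair_eqE !andbT.
  by case: u v => [[|[|//]] ?] [[|[|//]] ?]; rewrite /= ?addr0 ?add0r.
have vE u v : ketPhi2 R (mxtens_index (u, v)) 0 = (sqrtC 2)^-1 * (u == v)%:R.
  by rewrite /ketPhi2 mxE wE.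
have s2 : ((sqrtC 2)^-1)^* = (sqrtC 2)^-1 :> C.
  by apply/CrealP; rewrite ger0_real // invr_ge0 sqrtC_ge0 ler0n.
have vCE u v : (ketPhi2 R)^t* 0 (mxtens_index (u, v)) = (sqrtC 2)^-1 * (u == v)%:R.
  by rewrite 2!mxE vE rmorphM /= s2 rmorph_nat.
rewrite /Phi2 mxE big_ord1 vE vCE.
by rewrite mulrACA -invfM -expr2 sqrtCK -natrM mulnb.
Qed.

Lemma Phi2_trmxC : (Phi2 R)^t* = Phi2 R.
Proof. by rewrite /Phi2 trmxC_mul trmxCK. Qed.

Lemma sum_mxtens m n (F : 'I_(m * n) -> C) :
  \sum_u F u = \sum_i \sum_j F (mxtens_index (i, j)).
Proof.
rewrite pair_bigA (reindex (@mxtens_index m n)) /=.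
  by apply: eq_bigr => -[i j].
exact: onW_bij (Bijective (@mxtens_indexK m n) (@mxtens_unindexK m n)).
Qed.

Lemma mxtrace_Phi2 : \tr (Phi2 R) = 1.
Proof.
rewrite /mxtrace sum_mxtens !big_ord_recl !big_ord0 !Phi2E /=.
by rewrite !mulr0 !mulr1 !addr0 !add0r; field.
Qed.

Lemma Phi2_idem : Phi2 R *m Phi2 R = Phi2 R.
Proof.
apply/matrixP => u v; case: (mxtens_indexP u) => i j; case: (mxtens_indexP v) => k l.
rewrite mxE sum_mxtens !big_ord_recl !big_ord0 !Phi2E /= !andbT !andbF.
by case: (i == j); case: (k == l); rewrite /= ?mulr0 ?mul0r ?addr0 ?add0r //; field.
Qed.

(** These are the entries of half the swap operator, hence the square 1/4 below. *)
Lemma ptrans_Phi2E (i j k l : 'I_2) :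
  ptrans (Phi2 R) (mxtens_index (i, j)) (mxtens_index (k, l)) =
  2^-1 * ((i == l) && (k == j))%:R.
Proof. by rewrite mxE !mxtensK Phi2E. Qed.

Lemma ptrans_Phi2_sqr :
  ptrans (Phi2 R) *m ptrans (Phi2 R) = (2^-1 * 2^-1) *: 1%:M.
Proof.
apply/matrixP => u v; case: (mxtens_indexP u) => i j; case: (mxtens_indexP v) => k l.
rewrite mxE sum_mxtens (bigD1 j) //= (bigD1 i) //= !ptrans_Phi2E !eqxx /= mulr1.
rewrite [X in _ + X + _]big1 => [|s /negPf si]; last first.
  by rewrite ptrans_Phi2E eq_sym si mulr0 mul0r.
rewrite [X in _ + X]big1 => [|t /negPf tj]; last first.
  by rewrite big1 // => s _; rewrite ptrans_Phi2E tj andbF mulr0 mul0r.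
rewrite !addr0 !mxE (can_eq (@mxtens_indexK _ _)) xpair_eqE mulrA.
by rewrite andbC [k == i]eq_sym.
Qed.

(** Both Y = c - X and Y = c + X satisfy Y^2 = 2cY, so each is a positive multiple of its own Gram
    matrix. *)
Lemma herm_sqr_dominated n (X : 'M[C]_n) (c : R) : 0 < c -> X^t* = X ->
  X *m X = (c%:C * c%:C) *: 1%:M -> dominated X (c%:C%:M).
Proof.
move=> c_gt0 hX XX; have c0 : 0 < c%:C by rewrite ltcR.
have sq (Y : 'M[C]_n) : Y^t* = Y -> Y *m Y = (2 * c%:C) *: Y -> psdmx Y.
  move=> hY YY; have -> : Y = (2 * c%:C)^-1 *: (Y^t* *m Y).
    by rewrite hY YY scalerA mulVf ?scale1r // mulf_neq0 ?pnatr_eq0 // gt_eqF.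
  apply: psdmxZ (psdmx_gram Y); rewrite invr_ge0 mulr_ge0 ?ler0n //.
  exact: ltW.
have cc : (c%:C%:M : 'M[C]_n)^t* = c%:C%:M.
  by rewrite tr_scalar_mx map_scalar_mx; congr _%:M; exact: conjc_real.
split; apply: sq; rewrite ?trmxCB ?trmxCD ?cc ?hX //.
  rewrite mulmxBl !mulmxBr XX !mul_scalar_mx !mul_mx_scalar -scalemx1 !scalerA.
  by apply/matrixP => i j; rewrite !mxE; ring.
rewrite mulmxDl !mulmxDr XX !mul_scalar_mx !mul_mx_scalar -scalemx1 !scalerA.
by apply/matrixP => i j; rewrite !mxE; ring.
Qed.

Lemma ptrans_Phi2_dominated : dominated (ptrans (Phi2 R)) ((2^-1 : R)%:C%:M).
Proof.
apply: herm_sqr_dominated; first by rewrite invr_gt0 ltr0n.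
  by rewrite ptrans_trmxC Phi2_trmxC.
by rewrite ptrans_Phi2_sqr fmorphV rmorph_nat.
Qed.

Lemma bipow_Phi2_dominated m : dominated (ptrans (bipow (Phi2 R) m))
  ((2^-1 ^+ m : R)%:C%:M).
Proof.
have := dominated_bipow m ptrans_Phi2_dominated.
by rewrite ptrans_bipow -scalemx1 bipowZ bipow1 -rmorphXn scalemx1.
Qed.

Lemma bipow_Phi2_chain m p : exists2 S, chain (bipow (Phi2 R) m) S p.+1 &
  \tr (S p) = (2 ^+ m : R)%:C.
Proof.
have c0 : 0 <= (2^-1 ^+ m : R)%:C by rewrite ler0c exprn_ge0 // invr_ge0.
exists (fun _ => (2^-1 ^+ m : R)%:C%:M); last first.
  rewrite mxtrace_scalar !powdimE -rmorphMn; congr (_%:C).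
  rewrite -mulr_natr !natrM !natrX mulrA -exprMn mulVf ?expr1n ?mul1r //.
apply/chainP => -[|i] _ /=; first exact: bipow_Phi2_dominated.
by rewrite ptrans_scalar; apply: dominated_refl; exact: psdmx_scalar c0.
Qed.

End MaximallyEntangled.

(** * The lower bound on the cost *)

Section LowerBound.
Variables (R : realType) (a b : nat).
Local Notation C := R[i].
Implicit Types rho : 'M[C]_(a * b).

Lemma dominated_mxtrace n (T S : 'M[C]_n) : dominated T S -> \tr T <= \tr S.
Proof.
move=> h; have := dominated_tr (dominated_refl (@psdmx1 R n)) h.
by rewrite !mul1mx.
Qed.

(** Keeps [chi] and [kappa] of a state at least 1, so that the logarithms are taken of positive
    numbers and are nonnegative. *)
Lemma chain_mxtrace rho S m i : chain rho S m -> (i < m)%N -> \tr rho <= \tr (S i).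
Proof.
move=> /chainP hS; elim: i => [|i IHi] im; have := dominated_mxtrace (hS _ im).
  by rewrite mxtrace_ptrans.
by rewrite mxtrace_ptrans; apply: le_trans; exact: IHi (ltnW im).
Qed.

Lemma state_herm n (rho : 'M[C]_n) : is_state rho -> rho^t* = rho.
Proof. by case=> h _; exact: psdmx_herm h. Qed.

Lemma chi_ge p rho (r : R) : is_state rho ->
  (forall S, chain rho S p.+1 -> r <= complex.Re (\tr (S p))) -> r <= chi p rho.
Proof.
move=> /state_herm hrho h; apply: lb_le_inf; last by move=> _ [S hS ->]; exact: h.
have [c _ hc] := exists_chain p.+1 hrho.
by exists (complex.Re (\tr ((c p)%:C%:M : 'M[C]_(a * b)))), (fun i => (c i)%:C%:M).
Qed.

Lemma chain_ge1 rho S m i : is_state rho -> chain rho S m -> (i < m)%N ->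
  1 <= complex.Re (\tr (S i)).
Proof.
move=> [_ trrho] hS im; have := chain_mxtrace hS im; rewrite trrho.
by rewrite lecE => /andP[].
Qed.

Lemma chi_ge1 p rho : is_state rho -> 1 <= chi p rho.
Proof.
by move=> st; apply: (chi_ge st) => S hS; exact: (chain_ge1 st hS (ltnSn p)).
Qed.

Lemma ln2_gt0 : 0 < ln 2 :> R. Proof. by rewrite ln_gt0 // ltr1n. Qed.

Lemma achievable_ge p rho r : is_state rho -> 0 <= r -> achievable rho r ->
  E_chi p rho <= r.
Proof.
move=> st r0 [N _ hN].
(* A single block length n suffices, as chi_p(rho)^n <= 2^m with m <= rn already bounds r; the
   successor keeps n positive. *)
have [L pptL Lrho] := hN N.+1 (leqnSn N).
set m := Num.truncn _ in L pptL Lrho.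
have [S hS trS] := bipow_Phi2_chain R m p.
have [T hT trT] := PPT_channel_chain pptL hS.
rewrite Lrho in hT; have := chi_bipow (state_herm st) hT.
rewrite trT trS /= => h.
have chi_gt0 : 0 < chi p rho by apply: lt_le_trans (chi_ge1 p st).
rewrite /E_chi /log2 ler_pdivrMr ?ln2_gt0 //.
rewrite -(ler_pM2l (ltr0Sn R N)) mulr_natl -lnXn //.
apply: (@le_trans _ _ (ln (2 ^+ m))); first by rewrite ler_ln ?posrE ?exprn_gt0.
rewrite lnXn // -[X in X <= _]mulr_natl mulrA ler_pM2r ?ln2_gt0 // mulrC.
by rewrite truncn_le // mulr_ge0.
Qed.

Lemma E_chi_le_cost p rho : is_state rho ->
  ((E_chi p rho)%:E <= E_c_PPT_exact rho)%E.
Proof.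
move=> st; apply: le_ereal_inf_tmp => _ [r [r0 hr] <-]; rewrite lee_fin.
exact: achievable_ge st r0 hr.
Qed.

End LowerBound.

(** * Measure-and-prepare channels *)

Section MeasurePrepare.
Variables (R : realType) (m n : nat).
Local Notation C := R[i].
Variables (E0 E1 : 'M[C]_m) (s0 s1 : 'M[C]_n).

Definition measure_prepare (X : 'M[C]_m) : 'M[C]_n :=
  \tr (X *m E0) *: s0 + \tr (X *m E1) *: s1.

Lemma measure_prepare_is_linear : linear measure_prepare.
Proof.
move=> c X Y; rewrite /measure_prepare !mulmxDl -!scalemxAl !mxtraceD !mxtraceZ.
by rewrite !scalerDl scalerDr !scalerA addrACA.
Qed.

HB.instance Definition _ :=
  GRing.isLinear.Build C 'M[C]_m 'M[C]_n *:%R measure_prepare measure_prepare_is_linear.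

(** The quadratic form at v is the trace of X against the tensor product of the rank-one matrix of v
    with E. *)
Lemma psdmx_partial_trace k (X : 'M[C]_(k * m)) (E : 'M[C]_m) :
  psdmx X -> psdmx E -> psdmx (\matrix_(p < k, q < k)
    \tr ((\matrix_(s, t) X (mxtens_index (p, s)) (mxtens_index (q, t))) *m E)).
Proof.
move=> pX pE v; set Y := \matrix_(p, q) _.
suff -> : (v^t* *m Y *m v) 0 0 = \tr (X *m ((v *m v^t*) *t E)).
  exact: mxtraceM_ge0 pX (psdmx_tens (rank1_ge0 v) pE).
rewrite /mxtrace sum_mxtens mxE.
under eq_bigr do rewrite mxE big_distrl /=.
rewrite exchange_big; apply: eq_bigr => p _ /=.
under [RHS]eq_bigr do rewrite mxE sum_mxtens.
rewrite [RHS]exchange_big; apply: eq_bigr => q _ /=.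
rewrite [Y p q]mxE /mxtrace big_distrr big_distrl /=; apply: eq_bigr => s _.
rewrite [(_ *m E) s s]mxE big_distrr big_distrl /=; apply: eq_bigr => t _.
rewrite tensmxE [(v *m _) q p]mxE big_ord1 [(\matrix_(_, _) _) s t]mxE.
by move: (X _ _) (E _ _) (v _ _) ((v^t*) _ _) => x e y z; ring.
Qed.

Lemma measure_prepare_cp : psdmx E0 -> psdmx E1 -> psdmx s0 -> psdmx s1 ->
  completely_positive measure_prepare.
Proof.
move=> pE0 pE1 ps0 ps1 k X pX.
have := psdmxD (psdmx_tens (psdmx_partial_trace pX pE0) ps0)
               (psdmx_tens (psdmx_partial_trace pX pE1) ps1).
congr psdmx; apply/matrixP => u v.
by rewrite [LHS]mxE [RHS]mxE /measure_prepare !mxE.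
Qed.

End MeasurePrepare.

Section Protocol.

(** An entry of the identity that turns the partially transposed protocol into a measurement with
    effects c + Phi^Gamma and c - Phi^Gamma: x is Tr (X Phi^Gamma), y is Tr X, and r, t are entries
    of rho^Gamma and T. *)
Lemma twirl_decomposition (F : numFieldType) (c M s x y r t : F) : c * M = 1 ->
  x * r + (y - x) * (s * t) =
  (c * y + x) * (2^-1 * ((M - 1) * s * t + r)) +
  (c * y - x) * (2^-1 * ((M + 1) * s * t - r)).
Proof.
move=> cM.
have -> : (c * y + x) * (2^-1 * ((M - 1) * s * t + r)) +
    (c * y - x) * (2^-1 * ((M + 1) * s * t - r)) =
    x * r + (c * M * y - x) * (s * t) by field.
by rewrite cM mul1r.
Qed.

Variables (R : realType) (a b : nat).
Local Notation C := R[i].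
Implicit Types rho T : 'M[C]_(a * b).

(* Measure whether the input is the maximally entangled state; prepare [rho]
   if it is, and the normalization of [ptrans T] otherwise. *)
Lemma PPT_protocol rho T (t : R) m : is_state rho ->
  dominated (ptrans rho) T -> psdmx (ptrans T) -> \tr T = t%:C -> 1 <= t ->
  t + 1 <= 2 ^+ m ->
  exists2 L : {linear 'M[C]_(powdim 2 m * powdim 2 m) -> 'M[C]_(a * b)},
    PPT_channel L & L (bipow (Phi2 R) m) = rho.
Proof.
move=> [prho trrho] rhoT pTG trT t1 tm.
have t0 : 0 < t by apply: lt_le_trans t1.
pose Phi := bipow (Phi2 R) m.
have PhiPhi : Phi *m Phi = Phi by rewrite /Phi bipowM Phi2_idem.
have trPhi : \tr Phi = 1 by rewrite /Phi mxtrace_bipow mxtrace_Phi2 expr1n.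
have hPhi : Phi^t* = Phi by rewrite /Phi bipow_trmxC Phi2_trmxC.
have pPhi : psdmx Phi by have := psdmx_gram Phi; rewrite hPhi PhiPhi.
have pPhi' : psdmx (1%:M - Phi).
  have := psdmx_gram (1%:M - Phi); rewrite trmxCB trmxC1 hPhi.
  by rewrite mulmxBl mul1mx mulmxBr mulmx1 PhiPhi subrr subr0.
have tinv0 : 0 <= (t^-1)%:C by rewrite ler0c invr_ge0 ltW.
pose G := (t^-1)%:C *: ptrans T.
have pG : psdmx G by exact: psdmxZ tinv0 pTG.
have trG : \tr G = 1.
  rewrite /G mxtraceZ mxtrace_ptrans trT -rmorphM mulVf ?rmorph1 //.
  by rewrite gt_eqF.
pose L := measure_prepare Phi (1%:M - Phi) rho G.
exists L; last first.
  rewrite /L /= /measure_prepare mulmxBr mulmx1 PhiPhi subrr mxtrace0 trPhi.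
  by rewrite scale1r scale0r addr0.
split; first exact: measure_prepare_cp.
  have [p1 p2] := bipow_Phi2_dominated R m.
  rewrite -/Phi in p1 p2; set c : C := (2^-1 ^+ m)%:C in p1 p2.
  pose M : C := (2 ^+ m)%:C; pose s : C := (t^-1)%:C.
  (* The operators prepared on the two outcomes. As T dominates rho^Gamma, they are positive once (M
     - 1) s and (M + 1) s are at least 1; the first condition is exactly t + 1 <= 2^m. *)
  pose sp := 2^-1 *: (((M - 1) * s) *: T + ptrans rho).
  pose sm := 2^-1 *: (((M + 1) * s) *: T - ptrans rho).
  have cM : c * M = 1.
    by rewrite /c /M -rmorphM -exprMn mulVf ?expr1n ?rmorph1 // pnatr_eq0.
  have pT := dominated_psd rhoT.
  have split_T (k : C) : k *: T = (k - 1) *: T + T.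
    by rewrite scalerBl scale1r subrK.
  have ps : (1 : C) <= (M - 1) * s.
    rewrite /M /s -(rmorph1 (real_complex R)) -rmorphB -rmorphM lecR.
    by rewrite ler_pdivlMr // mul1r lerBrDr.
  have ms : (1 : C) <= (M + 1) * s.
    apply: le_trans ps _; rewrite ler_wpM2r //.
    by rewrite lerD2l -subr_ge0 opprK addr_ge0 ?ler01.
  have psp : psdmx sp.
    apply: psdmxZ (half_ge0 R) _; rewrite split_T -addrA; apply: psdmxD rhoT.2.
    by apply: psdmxZ pT; rewrite subr_ge0.
  have psm : psdmx sm.
    apply: psdmxZ (half_ge0 R) _; rewrite split_T -addrA; apply: psdmxD rhoT.1.
    by apply: psdmxZ pT; rewrite subr_ge0.
  have := measure_prepare_cp p2 p1 psp psm.
  congr completely_positive; apply/funext => X; rewrite /L /= /measure_prepare.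
  have ptE x y : ptrans (x *: rho + y *: G) = x *: ptrans rho + y *: (s *: T).
    have GE : ptrans G = s *: T by rewrite /G linearZ /= ptransK.
    by rewrite linearP linearZ /= GE.
  have e1 : \tr (ptrans X *m Phi) = \tr (X *m ptrans Phi).
    exact: mxtraceM_ptransl.
  have e2 : \tr (ptrans X *m (1%:M - Phi)) = \tr X - \tr (X *m ptrans Phi).
    by rewrite mulmxBr mulmx1 raddfB /= mxtrace_ptrans e1.
  have e3 : \tr (X *m (c%:M + ptrans Phi)) = c * \tr X + \tr (X *m ptrans Phi).
    by rewrite mulmxDr mxtraceD mul_mx_scalar mxtraceZ.
  have e4 : \tr (X *m (c%:M - ptrans Phi)) = c * \tr X - \tr (X *m ptrans Phi).
    by rewrite mulmxBr raddfB /= mul_mx_scalar mxtraceZ.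
  rewrite ptE e1 e2 e3 e4 /sp /sm.
  move: (\tr X) (\tr (X *m ptrans Phi)) (ptrans rho) => y x r.
  apply/matrixP => i j; rewrite !mxE; exact/esym/twirl_decomposition.
move=> X; rewrite /L /= /measure_prepare mxtraceD 2!mxtraceZ trrho trG !mulr1.
by rewrite -mxtraceD -mulmxDr addrC subrK mulmx1.
Qed.

End Protocol.

(** * From chains for [kappa] to achievable rates *)

Section KappaWitness.
Variables (R : realType) (a b : nat).
Local Notation C := R[i].
Implicit Types (rho T : 'M[C]_(a * b)) (S : nat -> 'M[C]_(a * b)).

(* T = S_0 + S_1^Gamma + S_2 + S_3^Gamma + ... *)
Lemma kappa1_witness q rho S : chain rho S q.+1 -> psdmx (ptrans (S q)) ->
  exists T, [/\ psdmx (T - S 0%N), psdmx (ptrans T) &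
    \tr T <= q.+1%:R * \tr (S q)].
Proof.
elim: q rho S => [|q IHq] rho S hS pS.
  by exists (S 0%N); split; [rewrite subrr; exact: psdmx0|exact: pS|rewrite mul1r].
have hS' : chain (S 0%N) (fun i => S i.+1) q.+1.
  by apply/chainP => i iq; have := (chainP _ _ _).1 hS i.+1 iq; case: i iq.
have [T [h1 h2 h3]] := IHq _ _ hS' pS.
(* The tail T satisfies T >= S_1, so the partial transpose S_0^Gamma + T of the new witness is at
   least S_0^Gamma + S_1 >= 0. *)
exists (S 0%N + ptrans T); split.
- by rewrite addrAC subrr add0r.
- have [_ h] := (chainP _ _ _).1 hS 1%N (isT : (1 < q.+2)%N).
  rewrite linearD /= ptransK; have := psdmxD h h1.
  by rewrite /= [S 1%N + _]addrC addrACA subrr addr0.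
- rewrite mxtraceD mxtrace_ptrans -natr1 mulrDl mul1r addrC lerD //.
  exact: chain_mxtrace hS' (ltnSn q).
Qed.

Lemma chain_bipow rho S m n : chain rho S m ->
  chain (bipow rho n) (fun i => bipow (S i) n) m.
Proof.
move=> /chainP hS; apply/chainP => i im; have := dominated_bipow n (hS i im).
by rewrite -ptrans_bipow; case: i im.
Qed.

Lemma bipow_state rho n : is_state rho -> is_state (bipow rho n).
Proof.
by case=> h1 h2; split; [exact: psdmx_bipow h1|rewrite mxtrace_bipow h2 expr1n].
Qed.

End KappaWitness.

Lemma rate_arith (R : realFieldType) (x l lt r n m : R) :
  x + l < n * (r * l - lt) -> r * n * l < (m + 1) * l -> x + n * lt <= m * l.
Proof. lra. Qed.

Section UpperBound.
Variables (R : realType) (a b : nat).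
Local Notation C := R[i].
Implicit Types (rho T : 'M[C]_(a * b)) (S : nat -> 'M[C]_(a * b)).

(** The witness is formed from the tensor power of the chain, and not the reverse, so that the
    factor [q.+1] is not raised to the power n. *)
Lemma kappa1_witness_bipow q rho S n : is_state rho ->
  chain rho S q.+1 -> psdmx (ptrans (S q)) ->
  exists (T : 'M[C]_(powdim a n * powdim b n)) (t : R),
  [/\ dominated (ptrans (bipow rho n)) T, psdmx (ptrans T),
    \tr T = t%:C, 1 <= t & t <= q.+1%:R * complex.Re (\tr (S q)) ^+ n].
Proof.
move=> st hS pS; have hSn := chain_bipow n hS.
have pSn : psdmx (ptrans (bipow (S q) n)) by rewrite ptrans_bipow; exact: psdmx_bipow.
have [T [h1 h2 h3]] := kappa1_witness hSn pSn.
have dT := dominated_trans ((chainP _ _ _).1 hSn 0%N isT) h1.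
have [tE _] := psdmx_ge0_complex (dominated_psd dT).
have [trS _] := psdmx_ge0_complex (dominated_psd ((chainP _ _ _).1 hS q (ltnSn q))).
exists T, (complex.Re (\tr T)); split => //.
  have [_ tr1] := bipow_state n st.
  by have := dominated_mxtrace dT; rewrite mxtrace_ptrans tr1 lecE => /andP[].
rewrite -lecR -tE; apply: le_trans h3 _.
by rewrite mxtrace_bipow trS rmorphM rmorphXn rmorph_nat.
Qed.

Lemma kappa_le q rho S : chain rho S q.+1 -> psdmx (ptrans (S q)) ->
  kappa q.+1 rho <= complex.Re (\tr (S q)).
Proof.
move=> h1 h2; apply: ge_inf; last by exists S.
exists 0 => _ [T [/chainP hT _] ->].
by have [] // := psdmx_ge0_complex (dominated_psd (hT q _)).
Qed.

Lemma kappa_ge q rho (r : R) : is_state rho ->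
  (forall S, chain rho S q.+1 -> psdmx (ptrans (S q)) -> r <= complex.Re (\tr (S q))) ->
  r <= kappa q.+1 rho.
Proof.
move=> /state_herm hrho h; apply: lb_le_inf; last by move=> _ [S [h1 h2] ->]; exact: h.
have [c c0 hc] := exists_chain q.+1 hrho.
exists (complex.Re (\tr ((c q)%:C%:M : 'M[C]_(a * b)))), (fun i => (c i)%:C%:M) => //.
by split=> //=; rewrite ptrans_scalar; apply: psdmx_scalar; rewrite ler0c.
Qed.

Lemma kappa_ge1 q rho : is_state rho -> 1 <= kappa q.+1 rho.
Proof.
by move=> st; apply: (kappa_ge st) => S hS _; exact: (chain_ge1 st hS (ltnSn q)).
Qed.

Lemma kappa_adherent q rho (e : R) : is_state rho -> 0 < e ->
  exists S, [/\ chain rho S q.+1, psdmx (ptrans (S q)) &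
    complex.Re (\tr (S q)) < kappa q.+1 rho + e].
Proof.
move=> st e0; apply: contrapT => nS.
suff : kappa q.+1 rho + e <= kappa q.+1 rho by rewrite gerDl leNgt e0.
apply: (kappa_ge st) => S h1 h2; rewrite leNgt; apply/negP => h3.
by apply: nS; exists S.
Qed.

Lemma achievable_of_chain q rho S (r : R) : is_state rho ->
  chain rho S q.+1 -> psdmx (ptrans (S q)) -> 0 <= r ->
  ln (complex.Re (\tr (S q))) < r * ln 2 -> achievable rho r.
Proof.
move=> st hS pS r0; set t := complex.Re _ => tr.
have t1 : 1 <= t by exact: chain_ge1 st hS (ltnSn q).
have t0 : 0 < t by apply: lt_le_trans t1.
(* Beyond this n the slack n (r ln 2 - ln t) pays for the prefactor [q.+2] and for the bit lost in
   rounding rn down. *)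
pose N := Num.truncn ((ln q.+2%:R + ln 2) / (r * ln 2 - ln t)).
exists N.+1 => //= n Nn.
have [T [s [h1 h2 h3 h4 h5]]] := kappa1_witness_bipow n st hS pS.
apply: (PPT_protocol (bipow_state n st) h1 h2 h3 h4).
(* The 1 added in the protocol is absorbed by passing from [q.+1] to [q.+2], as t^n >= 1. *)
apply: (@le_trans _ _ (q.+2%:R * t ^+ n)).
  by rewrite -natr1 mulrDl mul1r lerD // exprn_ege1.
rewrite -ler_ln ?posrE ?mulr_gt0 ?exprn_gt0 //.
rewrite lnM ?posrE ?exprn_gt0 // !lnXn //.
have rn := truncnS_gt (r * n%:R).
have nN : (ln q.+2%:R + ln 2) / (r * ln 2 - ln t) < n%:R.
  apply: lt_le_trans (truncnS_gt _) _; by rewrite ler_nat.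
rewrite ltr_pdivrMr ?subr_gt0 // in nN.
set m := Num.truncn _ in rn *.
have : (r * n%:R) * ln 2 < m.+1%:R * ln 2 :> R by rewrite ltr_pM2r ?ln2_gt0.
rewrite -[m.+1%:R]natr1 -[ln t *+ n]mulr_natl -[ln 2 *+ m]mulr_natl; exact: rate_arith nN.
Qed.

Lemma cost_le_E_kappa q rho : is_state rho ->
  (E_c_PPT_exact rho <= (E_kappa q.+1 rho)%:E)%E.
Proof.
move=> st; apply/lee_addgt0Pr => e e0; rewrite -EFinD.
have k1 := kappa_ge1 q st.
have k0 : 0 < kappa q.+1 rho by apply: lt_le_trans k1.
have l2 := @ln2_gt0 R.
(* The additive slack in the trace that amounts to e on the scale of [log2]. *)
have ee : 0 < kappa q.+1 rho * (expR (e * ln 2) - 1).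
  by rewrite mulr_gt0 // subr_gt0 expR_gt1 mulr_gt0.
have [S [h1 h2 h3]] := kappa_adherent q st ee.
apply: ge_ereal_inf; exists (E_kappa q.+1 rho + e)%:E => //.
have E0 : 0 <= E_kappa q.+1 rho.
  by rewrite /E_kappa /log2; apply: divr_ge0 (ltW l2); exact: ln_ge0.
have r0 : 0 <= E_kappa q.+1 rho + e by exact: addr_ge0 E0 (ltW e0).
exists (E_kappa q.+1 rho + e) => //; split => //.
apply: (achievable_of_chain st h1 h2 r0).
rewrite mulrDl /E_kappa /log2 divfK ?gt_eqF // -[e * _]expRK -lnM ?posrE ?expR_gt0 //.
have tr0 := lt_le_trans ltr01 (chain_ge1 st h1 (ltnSn q)).
rewrite ltr_ln ?posrE ?mulr_gt0 ?expR_gt0 //.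
by move: h3; rewrite mulrBr mulr1 addrC subrK.
Qed.

End UpperBound.

(** * Making a partial transpose positive by means of local matrix units *)

Section MatrixUnits.
Variables (R : realType) (n d : nat).
Local Notation C := R[i].
Variable e : 'I_d -> 'I_d -> 'M[C]_n.
Hypothesis e_trmxC : forall k l, (e k l)^t* = e l k.
Hypothesis e_sum : \sum_k e k k = 1%:M.
Hypothesis e_mul : forall k l, e k l *m e l k = e k k.

(** For the units of B this is the A-marginal of N tensored with the identity, and [unit_transpose]
    is N^Gamma; for those of A it is the identity tensored with the B-marginal, and [unit_transpose]
    is the full transpose of N^Gamma. *)
Definition unit_average (N : 'M[C]_n) := \sum_k \sum_l e l k *m N *m e k l.
Definition unit_transpose (N : 'M[C]_n) := \sum_k \sum_l e k l *m N *m e k l.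

Lemma mxtrace_unit_average N : \tr (unit_average N) = d%:R * \tr N.
Proof.
rewrite /unit_average raddf_sum /=.
under eq_bigr do rewrite raddf_sum /=.
under eq_bigr do under eq_bigr do rewrite mxtrace_mulC mulmxA e_mul.
under eq_bigr do rewrite sumr_const card_ord.
rewrite sumrMnl -raddf_sum /= -mulmx_suml e_sum mul1mx.
by rewrite mulr_natl.
Qed.

(** Twice the operator is the sum of the conjugates of N by the Hermitian matrices e k l + e l k. *)
Lemma unit_transpose_psd N : psdmx N -> psdmx (unit_average N + unit_transpose N).
Proof.
move=> pN; apply: psdmx_half.
have : psdmx (\sum_k \sum_l (e k l + e l k)^t* *m N *m (e k l + e l k)).
  by apply: psdmx_sum => k _; apply: psdmx_sum => l _; exact: psdmx_conj pN.
congr psdmx.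
have E k l : (e k l + e l k)^t* *m N *m (e k l + e l k) =
    (e l k *m N *m e k l + e k l *m N *m e k l) +
    (e k l *m N *m e l k + e l k *m N *m e l k).
  rewrite trmxCD !e_trmxC mulmxDl mulmxDr !mulmxDl.
  by rewrite [X in _ + X = _]addrC.
under eq_bigr do under eq_bigr do rewrite E.
under eq_bigr do rewrite !big_split /=.
have avE : \sum_k \sum_l e k l *m N *m e l k = unit_average N.
  exact: exchange_big.
have trE : \sum_k \sum_l e l k *m N *m e l k = unit_transpose N.
  exact: exchange_big.
by rewrite !big_split /= avE trE.
Qed.

(** The pinching D lies in between: it consists of the diagonal terms of the average, and d D - N is
    half the sum of the conjugates of N by e k k - e l l. *)
Lemma unit_average_ge N : psdmx N -> psdmx (d%:R *: unit_average N - N).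
Proof.
move=> pN; pose D := \sum_k e k k *m N *m e k k.
have cross (V : zmodType) (A B P Q : V) : A - P + (B - Q) = A - Q + (B - P).
  by rewrite addrACA [RHS]addrACA [X in _ + X = _]addrC.
have p1 : psdmx (unit_average N - D).
  rewrite /unit_average /D -sumrB; apply: psdmx_sum => k _.
  rewrite (bigD1 k isT) /= addrAC subrr add0r; apply: psdmx_sum => l _.
  by rewrite -e_trmxC; exact: psdmx_conj pN.
have p2 : psdmx (d%:R *: D - N).
  apply: psdmx_half.
  have : psdmx (\sum_k \sum_l (e k k - e l l)^t* *m N *m (e k k - e l l)).
    by apply: psdmx_sum => k _; apply: psdmx_sum => l _; exact: psdmx_conj pN.
  congr psdmx.
  have E k l : (e k k - e l l)^t* *m N *m (e k k - e l l) =
      (e k k *m N *m e k k - e k k *m N *m e l l) +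
      (e l l *m N *m e l l - e l l *m N *m e k k).
    rewrite trmxCB !e_trmxC mulmxBl mulmxBr !mulmxBl opprB.
    exact: cross.
  under eq_bigr do under eq_bigr do rewrite E.
  under eq_bigr do rewrite big_split /= !sumrB.
  rewrite big_split /= !sumrB.
  have S1 : \sum_(k < d) \sum_(l < d) e k k *m N *m e k k = d%:R *: D.
    under eq_bigr do rewrite sumr_const card_ord -scaler_nat.
    by rewrite -scaler_sumr.
  have S2 : \sum_(k < d) \sum_(l < d) e k k *m N *m e l l = N.
    under eq_bigr do rewrite -mulmx_sumr e_sum mulmx1.
    by rewrite -mulmx_suml e_sum mul1mx.
  have S1' : \sum_(k < d) \sum_(l < d) e l l *m N *m e l l = d%:R *: D.
    by rewrite exchange_big.
  have S2' : \sum_(k < d) \sum_(l < d) e l l *m N *m e k k = N.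
    by rewrite exchange_big.
  by rewrite S1 S2 S1' S2'.
have := psdmxD (psdmxZ (ler0n C d) p1) p2.
by rewrite scalerBr addrA subrK.
Qed.

End MatrixUnits.

Section LocalMatrixUnits.
Variables (R : realType) (a b : nat).
Local Notation C := R[i].
Implicit Types N : 'M[C]_(a * b).

Definition unitB (k l : 'I_b) : 'M[C]_(a * b) := (1%:M : 'M[C]_a) *t delta_mx k l.
Definition unitA (k l : 'I_a) : 'M[C]_(a * b) := delta_mx k l *t (1%:M : 'M[C]_b).

Lemma unitB_trmxC k l : (unitB k l)^t* = unitB l k.
Proof. by rewrite /unitB trmx_tens map_mxT trmxC1 trmxC_delta. Qed.

Lemma unitA_trmxC k l : (unitA k l)^t* = unitA l k.
Proof. by rewrite /unitA trmx_tens map_mxT trmxC1 trmxC_delta. Qed.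

Lemma tens11 m n : (1%:M : 'M[C]_m) *t (1%:M : 'M[C]_n) = 1%:M.
Proof.
apply/matrixP => u v.
case: (mxtens_indexP u) => i j; case: (mxtens_indexP v) => k l.
by rewrite tensmxE !mxE (can_eq (@mxtens_indexK _ _)) xpair_eqE -natrM mulnb.
Qed.

Lemma sum_delta_diag m : \sum_k delta_mx k k = 1%:M :> 'M[C]_m.
Proof. by rewrite mx1_sum_delta. Qed.

Lemma unitB_sum : \sum_k unitB k k = 1%:M.
Proof.
rewrite -(tens11 a b) -(sum_delta_diag b); apply/matrixP => u v.
by rewrite summxE !mxE summxE big_distrr; apply: eq_bigr => k _; rewrite !mxE.
Qed.

Lemma unitA_sum : \sum_k unitA k k = 1%:M.
Proof.
rewrite -(tens11 a b) -(sum_delta_diag a); apply/matrixP => u v.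
by rewrite summxE !mxE summxE big_distrl; apply: eq_bigr => k _; rewrite !mxE.
Qed.

Lemma unitB_mul k l : unitB k l *m unitB l k = unitB k k.
Proof. by rewrite /unitB tensmx_mul mul1mx mul_delta_mx. Qed.

Lemma unitA_mul k l : unitA k l *m unitA l k = unitA k k.
Proof. by rewrite /unitA tensmx_mul mul1mx mul_delta_mx. Qed.

Lemma unitB_conjE k l k' l' N i j i' j' :
  (unitB k l *m N *m unitB k' l') (mxtens_index (i, j)) (mxtens_index (i', j')) =
  ((j == k) && (j' == l'))%:R * N (mxtens_index (i, l)) (mxtens_index (i', k')).
Proof.
rewrite mxE sum_mxtens (bigD1 i' isT) /= (bigD1 k' isT) /=.
rewrite [X in _ + X + _]big1 => [|s /negPf sk]; last first.
  by rewrite [X in _ * X]tensmxE !mxE sk /= mulr0 mulr0.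
rewrite [X in _ + X]big1 => [|t /negPf ti]; last first.
  by rewrite big1 // => s _; rewrite [X in _ * X]tensmxE !mxE ti mul0r mulr0.
rewrite !addr0 [X in _ * X]tensmxE !mxE !eqxx mul1r /=.
rewrite sum_mxtens (bigD1 i isT) /= (bigD1 l isT) /=.
rewrite [X in _ + X + _]big1 => [|s /negPf sk]; last first.
  by rewrite [X in X * _]tensmxE !mxE sk andbF mulr0 mul0r.
rewrite [X in _ + X]big1 => [|t ti]; last first.
  by rewrite big1 // => s _; rewrite [X in X * _]tensmxE !mxE eq_sym (negPf ti) !mul0r.
rewrite !addr0 [X in X * _ * _]tensmxE !mxE !eqxx mul1r andbT.
by rewrite -mulrA [N _ _ * _]mulrC mulrA -natrM mulnb.
Qed.

Lemma unitA_conjE k l k' l' N i j i' j' :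
  (unitA k l *m N *m unitA k' l') (mxtens_index (i, j)) (mxtens_index (i', j')) =
  ((i == k) && (i' == l'))%:R * N (mxtens_index (l, j)) (mxtens_index (k', j')).
Proof.
rewrite mxE sum_mxtens (bigD1 k' isT) /= (bigD1 j' isT) /=.
rewrite [X in _ + X + _]big1 => [|s /negPf sk]; last first.
  by rewrite [X in _ * X]tensmxE !mxE sk /= !mulr0.
rewrite [X in _ + X]big1 => [|t /negPf ti]; last first.
  by rewrite big1 // => s _; rewrite [X in _ * X]tensmxE !mxE ti mul0r mulr0.
rewrite !addr0 [X in _ * X]tensmxE !mxE !eqxx mulr1 /=.
rewrite sum_mxtens (bigD1 l isT) /= (bigD1 j isT) /=.
rewrite [X in _ + X + _]big1 => [|s sk]; last first.
  by rewrite [X in X * _]tensmxE !mxE [j == s]eq_sym (negPf sk) mulr0 mul0r.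
rewrite [X in _ + X]big1 => [|t /negPf ti]; last first.
  by rewrite big1 // => s _; rewrite [X in X * _]tensmxE !mxE ti andbF !mul0r.
rewrite !addr0 [X in X * _ * _]tensmxE !mxE !eqxx mulr1 andbT.
by rewrite -mulrA [N _ _ * _]mulrC mulrA -natrM mulnb.
Qed.

Lemma sum_delta2 m (F : 'I_m -> 'I_m -> C) (j j' : 'I_m) :
  \sum_k \sum_l ((j == k) && (j' == l))%:R * F k l = F j j'.
Proof.
rewrite (bigD1 j isT) /= (bigD1 j' isT) /= !eqxx mul1r.
rewrite [X in _ + X + _]big1 => [|l lj]; last by rewrite eq_sym (negPf lj) mul0r.
rewrite [X in _ + X]big1 ?addr0 // => k kj; apply: big1 => l _.
by rewrite [j == k]eq_sym (negPf kj) mul0r.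
Qed.

Lemma unit_transposeB N : unit_transpose unitB N = ptrans N.
Proof.
apply/matrixP => u v.
case: (mxtens_indexP u) => i j; case: (mxtens_indexP v) => i' j'.
rewrite /unit_transpose mxE !mxtensK summxE.
under eq_bigr do rewrite summxE.
under eq_bigr do under eq_bigr do rewrite unitB_conjE.
exact: sum_delta2.
Qed.

Lemma unit_averageB_index N i j i' j' :
  unit_average unitB N (mxtens_index (i, j)) (mxtens_index (i', j')) =
  (j == j')%:R * \sum_k N (mxtens_index (i, k)) (mxtens_index (i', k)).
Proof.
rewrite /unit_average summxE big_distrr; apply: eq_bigr => k _ /=.
rewrite summxE; under eq_bigr do rewrite unitB_conjE.
rewrite -big_distrl /=; congr (_ * _); rewrite (bigD1 j isT) /= eqxx.
by rewrite big1 ?addr0 1?[j' == j]eq_sym // => l lj; rewrite eq_sym (negPf lj).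
Qed.

Lemma ptrans_unit_averageB N : ptrans (unit_average unitB N) = unit_average unitB N.
Proof.
apply/matrixP => u v.
case: (mxtens_indexP u) => i j; case: (mxtens_indexP v) => i' j'.
by rewrite mxE !mxtensK !unit_averageB_index eq_sym.
Qed.

Lemma unit_transposeA N : unit_transpose unitA N = (ptrans N)^T.
Proof.
apply/matrixP => u v.
case: (mxtens_indexP u) => i j; case: (mxtens_indexP v) => i' j'.
rewrite /unit_transpose 2!mxE !mxtensK summxE.
under eq_bigr do rewrite summxE.
under eq_bigr do under eq_bigr do rewrite unitA_conjE.
exact: (sum_delta2 (fun k l => N (mxtens_index (l, j)) (mxtens_index (k, j')))).
Qed.

Lemma unit_averageA_index N i j i' j' :
  unit_average unitA N (mxtens_index (i, j)) (mxtens_index (i', j')) =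
  (i == i')%:R * \sum_k N (mxtens_index (k, j)) (mxtens_index (k, j')).
Proof.
rewrite /unit_average summxE big_distrr; apply: eq_bigr => k _ /=.
rewrite summxE; under eq_bigr do rewrite unitA_conjE.
rewrite -big_distrl /=; congr (_ * _); rewrite (bigD1 i isT) /= eqxx.
by rewrite big1 ?addr0 1?[i' == i]eq_sym // => l lj; rewrite eq_sym (negPf lj).
Qed.

Lemma ptrans_unit_averageA N : (ptrans (unit_average unitA N))^T = unit_average unitA N.
Proof.
apply/matrixP => u v.
case: (mxtens_indexP u) => i j; case: (mxtens_indexP v) => i' j'.
by rewrite 2!mxE !mxtensK !unit_averageA_index eq_sym.
Qed.

Lemma psdmx_trmx n (A : 'M[C]_n) : psdmx A -> psdmx A^T.
Proof.
move=> pA v; have := pA (map_mx Num.Def.conjC v).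
have -> : (map_mx Num.Def.conjC v)^t* = v^T.
  by apply/matrixP => i j; rewrite !mxE conjCK.
congr (0 <= _); rewrite -[LHS]/((_ *m _) 0 0).
have -> : v ^t* *m A^T *m v = (v^T *m A *m map_mx Num.Def.conjC v)^T.
  by rewrite !trmx_mul trmxK mulmxA map_trmx.
by rewrite [RHS]mxE.
Qed.


(** The origin of d/(d+1): with c = 1/(m+1) one has c m - 1 = - c, so that Z^Gamma - N becomes a
    multiple of m X - N, which [unit_average_ge] makes positive. *)
Lemma dilation_coef (F : comNzRingType) (c m x y : F) : c * (m + 1) = 1 ->
  c * m * (x + y) - y = c * (m * x - y).
Proof.
move=> cm; apply/eqP; rewrite -subr_eq0; apply/eqP.
have -> : c * m * (x + y) - y - c * (m * x - y) = (c * (m + 1) - 1) * y by ring.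
by rewrite cm subrr mul0r.
Qed.

(* [Z] is d/(d+1) (NA + N^Gamma), [NA] being the marginal of [N] tensored with
   the identity of the smaller party. *)
Lemma PPT_dilation N : psdmx N ->
  exists Z, [/\ psdmx Z, psdmx (ptrans Z - N) & \tr Z = (minn a b)%:R * \tr N].
Proof.
move=> pN.
have aux d (X : 'M[C]_(a * b)) : psdmx (ptrans X + ptrans N) ->
    psdmx (d%:R *: X - N) -> \tr X = d%:R * \tr N ->
    exists Z, [/\ psdmx Z, psdmx (ptrans Z - N) & \tr Z = d%:R * \tr N].
  move=> h1 h2 h3; pose c : C := d.+1%:R^-1.
  have c0 : 0 <= c by rewrite invr_ge0 ler0n.
  have cd : c * d.+1%:R = 1 by rewrite mulVf // pnatr_eq0.
  have cd0 : 0 <= c * d%:R by rewrite mulr_ge0 // ler0n.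
  exists ((c * d%:R) *: (ptrans X + ptrans N)); split; first exact: psdmxZ cd0 h1.
    have -> : ptrans ((c * d%:R) *: (ptrans X + ptrans N)) - N = c *: (d%:R *: X - N).
      rewrite linearZ /= linearD /= !ptransK.
      by apply/matrixP => i j; rewrite !mxE; apply: dilation_coef; rewrite natr1.
    exact: psdmxZ c0 h2.
  rewrite mxtraceZ mxtraceD !mxtrace_ptrans h3 -{2}[\tr N]mul1r -mulrDl natr1.
  by rewrite mulrACA cd mul1r.
rewrite /minn; case: ifP => _.
  apply: (aux a (unit_average unitA N)).
  (* The units of A produce the partial transpose on A; a full transpose brings it back to B. *)
  - have := psdmx_trmx (unit_transpose_psd unitA_trmxC pN).
    by rewrite unit_transposeA linearD /= trmxK -{1}ptrans_unit_averageA trmxK.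
  - exact: (unit_average_ge (e := unitA) unitA_trmxC unitA_sum pN).
  - exact: (mxtrace_unit_average (e := unitA) unitA_sum unitA_mul N).
apply: (aux b (unit_average unitB N)).
- rewrite ptrans_unit_averageB -unit_transposeB.
  exact: (unit_transpose_psd (e := unitB) unitB_trmxC pN).
- exact: (unit_average_ge (e := unitB) unitB_trmxC unitB_sum pN).
- exact: (mxtrace_unit_average (e := unitB) unitB_sum unitB_mul N).
Qed.

End LocalMatrixUnits.


(** * Comparison of [kappa] with [chi] *)

Section Contraction.
Variables (R : realType) (a b : nat).
Local Notation C := R[i].
Implicit Types (rho : 'M[C]_(a * b)) (S : nat -> 'M[C]_(a * b)).
Local Notation d := (minn a b)%:R.

Lemma half_split (F : numFieldType) (x y z : F) :
  x + y = 2^-1 * (z + x) + (y - 2^-1 * (z - x)).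
Proof. by field. Qed.

Lemma ReB (x y : C) : complex.Re (x - y) = complex.Re x - complex.Re y.
Proof. by case: x; case: y. Qed.

Lemma ReD (x y : C) : complex.Re (x + y) = complex.Re x + complex.Re y.
Proof. by case: x; case: y. Qed.

Lemma Re_realM (x : R) (y : C) : complex.Re (x%:C * y) = x * complex.Re y.
Proof. by case: y => u v /=; rewrite mul0r subr0. Qed.

(** S_p^Gamma is (S_(p+1) + S_p^Gamma)/2 - N, where the first term is positive; adding Z to S_p
    compensates -N, because Z^Gamma >= N. *)
Lemma kappa_step_witness p rho S : chain rho S p.+2 ->
  kappa p.+1 rho <= complex.Re (\tr (S p)) +
    d / 2 * (complex.Re (\tr (S p.+1)) - complex.Re (\tr (S p))).
Proof.
move=> hS; have [h1 h2] := (chainP _ _ _).1 hS p.+1 (ltnSn _); rewrite /= in h1 h2.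
pose N := 2^-1 *: (S p.+1 - ptrans (S p)).
have half := half_ge0 R.
have pN : psdmx N by exact: psdmxZ half h1.
have [Z [pZ pZN trZ]] := PPT_dilation pN.
pose S' i := if i == p then S p + Z else S i.
have S'p : S' p = S p + Z by rewrite /S' eqxx.
have hS' : chain rho S' p.+1.
  apply/chainP => i ip.
  have -> : prev_op rho S' i = prev_op rho S i.
    by case: i ip => //= i ip; rewrite /S' ltn_eqF.
  have := (chainP _ _ _).1 hS i (ltnW ip); rewrite /S'; case: eqP => [->|_ //] h.
  by apply: dominated_trans h _; rewrite addrAC subrr add0r.
have pS' : psdmx (ptrans (S' p)).
  have -> : ptrans (S' p) = 2^-1 *: (S p.+1 + ptrans (S p)) + (ptrans Z - N).
    rewrite S'p linearD /= /N.
    move: (ptrans (S p)) (ptrans Z) (S p.+1) => P Q T.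
    by apply/matrixP => i j; rewrite !mxE; exact: half_split.
  exact: psdmxD (psdmxZ half h2) pZN.
apply: le_trans (kappa_le hS' pS') _; rewrite S'p mxtraceD ReD lerD2l trZ.
have -> : \tr N = (2^-1 : R)%:C * (\tr (S p.+1) - \tr (S p)).
  by rewrite /N mxtraceZ fmorphV rmorph_nat raddfB /= mxtrace_ptrans.
by rewrite -(rmorph_nat (real_complex R)) !Re_realM ReB mulrA.
Qed.

Lemma kappa_contraction p rho : is_state rho -> (2 : R) <= d ->
  2 / d * kappa p.+1 rho + (1 - 2 / d) * chi p rho <= chi p.+1 rho.
Proof.
move=> st d2; apply: (chi_ge st) => S hS.
have hS' : chain rho S p.+1.
  by apply/chainP => i ip; exact: ((chainP _ _ _).1 hS i (ltnW ip)).
have k := kappa_step_witness hS; have c := chi_le hS'.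
move: (kappa _ _) (chi _ _) (complex.Re _) (complex.Re _) k c => x y s t k c.
have d0 : 0 < d :> R by apply: lt_le_trans d2.
rewrite -(ler_pM2l (_ : 0 < d / 2 :> R)); last by rewrite divr_gt0.
have -> : d / 2 * (2 / d * x + (1 - 2 / d) * y) = x + (d / 2 - 1) * y.
  by field; rewrite gt_eqF.
(* Here d >= 2 enters: Tr S_p may be replaced by its lower bound [chi p rho] because d/2 - 1 is
   nonnegative. *)
have h : (d / 2 - 1) * y <= (d / 2 - 1) * t :> R.
  by rewrite ler_wpM2l // subr_ge0 ler_pdivlMr // mul1r.
by move: h k; lra.
Qed.

(** As S_p^Gamma >= 0, it dominates itself and can prolong the chain at the same trace; its partial
    transpose S_p is positive. *)
Lemma kappa_antimono p rho : is_state rho -> kappa p.+2 rho <= kappa p.+1 rho.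
Proof.
move=> st; apply: (kappa_ge st) => S hS pS.
pose S' i := if i == p.+1 then ptrans (S p) else S i.
have S'p : S' p.+1 = ptrans (S p) by rewrite /S' eqxx.
have hS' : chain rho S' p.+2.
  apply/chainP => i ip.
  have -> : prev_op rho S' i = prev_op rho S i.
    by case: i ip => //= i ip; rewrite /S' ltn_eqF.
  rewrite /S'; case: eqP => [->|/eqP ne] /=; first exact: dominated_refl pS.
  apply: ((chainP _ _ _).1 hS i _).
  by rewrite ltn_neqAle ne -ltnS ip.
have pS' : psdmx (ptrans (S' p.+1)).
  rewrite S'p ptransK.
  exact: dominated_psd ((chainP _ _ _).1 hS p (ltnSn p)).
by have := kappa_le hS' pS'; rewrite S'p mxtrace_ptrans.
Qed.

(** With the index of [kappa] frozen at p+1, the gap to chi_i shrinks by 1 - 2/d at each i, since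
    kappa_(i+1) >= kappa_(p+1); it starts from chi_0 >= 0. *)
Lemma kappa_le_chi p rho : is_state rho -> (2 : R) <= d ->
  (1 - (1 - 2 / d) ^+ p.+1) * kappa p.+1 rho <= chi p.+1 rho.
Proof.
move=> st d2; have d0 : 0 < d :> R by apply: lt_le_trans d2.
have [x0 x1] : 0 <= 1 - 2 / d :> R /\ 0 < 2 / d :> R.
  by rewrite subr_ge0 ler_pdivrMr // mul1r divr_gt0.
have anti i : (i <= p)%N -> kappa p.+1 rho <= kappa i.+1 rho.
  move=> ip; rewrite -(subnKC ip); elim: (p - i)%N => [|k IHk].
    by rewrite addn0.
  by rewrite addnS; exact: le_trans (kappa_antimono _ st) IHk.
have key i : (i <= p.+1)%N ->
    kappa p.+1 rho - chi i rho <= (1 - 2 / d) ^+ i * kappa p.+1 rho.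
  elim: i => [|i IHi] ip; first by rewrite mul1r gerBl chi_ge0.
  have h1 := kappa_contraction i st d2.
  have h2 := anti i ip; have h3 := IHi (ltnW ip).
  have h2' := ler_wpM2l (ltW x1) h2; have h3' := ler_wpM2l x0 h3.
  rewrite exprS -mulrA; apply: le_trans h3'.
  by move: (2 / d) h1 h2' => x h1 h2'; lra.
by have := key p.+1 (leqnn _); lra.
Qed.

End Contraction.

(** * Bounds on the regularization of [E_kappa] *)

Section KappaRate.
Variables (R : realType) (a b : nat).
Local Notation C := R[i].
Implicit Types (rho : 'M[C]_(a * b)).

(** An S feasible for kappa_1 satisfies S >= 0 and S^Gamma >= 0, so S, S^Gamma, S, ... is a chain of
    any length with constant trace. *)
Lemma kappa1_bipow_ge p rho n : is_state rho ->
  chi p rho ^+ n <= kappa 1 (bipow rho n).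
Proof.
move=> st; apply: (kappa_ge (bipow_state n st)) => S hS pS.
have dS := (chainP _ _ _).1 hS 0%N (ltnSn 0).
pose T i := if odd i then ptrans (S 0%N) else S 0%N.
have hT : chain (bipow rho n) T p.+1.
  apply/chainP => -[|i] _; first exact: dS.
  rewrite /T /=; case: (odd i) => /=; last exact: dominated_refl pS.
  by rewrite ptransK; exact: dominated_refl (dominated_psd dS).
apply: le_trans (chi_bipow (state_herm st) hT) _.
by rewrite /T; case: ifP => _; rewrite ?mxtrace_ptrans.
Qed.

Lemma kappa1_bipow_le q rho S n : is_state rho -> chain rho S q.+1 ->
  psdmx (ptrans (S q)) ->
  kappa 1 (bipow rho n) <= q.+1%:R * complex.Re (\tr (S q)) ^+ n.
Proof.
move=> st hS pS.
have [T [t [h1 h2 h3 _ h4]]] := kappa1_witness_bipow n st hS pS.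
have hT : chain (bipow rho n) (fun=> T) 1 by apply/chainP => -[|i] // _; exact: h1.
have := kappa_le hT h2; rewrite h3 => k; exact: le_trans k h4.
Qed.

Lemma E_chi_le_rate p rho n : is_state rho -> E_chi p rho <= E_kappa_rate rho n.+1.
Proof.
move=> st; have chi0 := lt_le_trans ltr01 (chi_ge1 p st).
have k0 := lt_le_trans ltr01 (kappa_ge1 0 (bipow_state n.+1 st)).
have n0 : 0 < n.+1%:R :> R by rewrite ltr0n.
rewrite /E_kappa_rate /E_chi /E_kappa /log2 mulrA ler_pM2r ?invr_gt0 ?ln2_gt0 //.
rewrite ler_pdivlMl // mulr_natl -lnXn // ler_ln ?posrE ?exprn_gt0 //.
exact: kappa1_bipow_ge.
Qed.

Lemma rate_le_E_kappa q rho n : is_state rho ->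
  E_kappa_rate rho n.+1 <= E_kappa q.+1 rho + log2 q.+1%:R / n.+1%:R.
Proof.
move=> st; have k0 := lt_le_trans ltr01 (kappa_ge1 0 (bipow_state n.+1 st)).
have n0 : 0 < n.+1%:R :> R by rewrite ltr0n.
have kq0 := lt_le_trans ltr01 (kappa_ge1 q st).
set A := kappa 1 (bipow rho n.+1) in k0 *.
(* With [kappa q.+1 rho] alone on the right, its infimum can be tested on one chain at a time. *)
suff h : (ln A - ln q.+1%:R) / n.+1%:R <= ln (kappa q.+1 rho).
  rewrite /E_kappa_rate /E_kappa /log2 mulrA [n.+1%:R^-1 * _]mulrC.
  rewrite [ln q.+1%:R / _ / _]mulrAC -mulrDl ler_pM2r ?invr_gt0 ?ln2_gt0 //.
  by move: h; rewrite mulrBl lerBlDr.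
rewrite -[leLHS]expRK ler_ln ?posrE ?expR_gt0 //.
apply: (kappa_ge st) => S hS pS.
have t0 := lt_le_trans ltr01 (chain_ge1 st hS (ltnSn q)).
rewrite -[leRHS]lnK ?posrE // ler_expR ler_pdivrMr // lerBlDl mulrC mulr_natl.
rewrite -lnXn // -lnM ?posrE ?exprn_gt0 // ler_ln ?posrE ?mulr_gt0 ?exprn_gt0 //.
exact: kappa1_bipow_le.
Qed.

End KappaRate.

(** * The exponential gap and the conclusion *)

Section Gap.
Variable R : realType.

(** Makes the logarithmic gap linear in z, hence exponential in p when z = (1 - 2/d)^p; it rests on
    ln (1 + x) <= x at x = z / (1 - z). *)
Lemma log2_inv_le (z r : R) : 0 <= z -> 0 < r -> z <= 1 - r ->
  log2 (1 / (1 - z)) <= z / r / ln 2.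
Proof.
move=> z0 r0 zr; have z1 : 0 < 1 - z by lra.
rewrite /log2 ler_pM2r ?invr_gt0 ?ln2_gt0 //.
have -> : 1 / (1 - z) = 1 + z / (1 - z) by field; rewrite gt_eqF.
have h : 0 <= z / (1 - z) by rewrite divr_ge0 // ltW.
apply: le_trans (le_ln1Dx _) _; first by apply: lt_le_trans h; rewrite oppr_lt0.
by rewrite ler_wpM2l // lef_pV2 ?posrE //; lra.
Qed.

Lemma E_kappa_le_E_chi a b (rho : 'M[R[i]]_(a * b)) d p : minn a b = d -> (2 <= d)%N ->
  is_state rho -> E_kappa p.+1 rho <=
    E_chi p.+1 rho + log2 (1 / (1 - (1 - 2 / d%:R) ^+ p.+1)).
Proof.
move=> <- d2 st; have d2' : 2 <= (minn a b)%:R :> R by rewrite ler_nat.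
have := kappa_le_chi p st d2'; set z := _ ^+ _ => h.
have d0 : 0 < (minn a b)%:R :> R by apply: lt_le_trans d2'.
have z1 : 0 < 1 - z.
  rewrite subr_gt0 exprn_ilt1 // ?subr_ge0 ?ler_pdivrMr ?mul1r //.
  by rewrite gtrBl divr_gt0.
have k0 := lt_le_trans ltr01 (kappa_ge1 p st).
have c0 := lt_le_trans ltr01 (chi_ge1 p.+1 st).
rewrite /E_kappa /E_chi /log2 -mulrDl ler_pM2r ?invr_gt0 ?ln2_gt0 //.
rewrite div1r lnV ?posrE // lerBrDr -lnM ?posrE // ler_ln ?posrE ?mulr_gt0 //.
by rewrite mulrC.
Qed.

Lemma dist_le_of_sandwich (F : realFieldType) (e l r x y s v : F) :
  `|x - l| <= v -> `|y - l| <= v -> x <= r -> r <= y + s ->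
  v <= e / 2 -> s <= e / 2 -> `|l - r| <= e.
Proof.
by rewrite !ler_distl => /andP[? _] /andP[_ ?] ? ? ? ?; apply/andP; split; lra.
Qed.

Lemma cvg_of_bound (u v : nat -> R) (l : R) : v @ \oo --> 0 ->
  (forall p, (0 < p)%N -> `|u p - l| <= v p) -> u @ \oo --> l.
Proof.
move=> v0 h; apply/cvgrPdist_le => e e0.
move/cvgrPdist_le : v0 => /(_ e e0) [N _ hN].
exists N.+1 => // p Np; rewrite /= in Np; rewrite distrC.
apply: le_trans (h p (leq_trans (ltn0Sn N) Np)) _.
have := hN p (ltnW Np); rewrite /= sub0r normrN; apply: le_trans; exact: ler_norm.
Qed.

End Gap.

Theorem theorem1 (R : realType) (d : nat) (hd : (2 <= d)%N) :
  (forall (a b : nat) (rho : 'M[R[i]]_(a * b)),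
     minn a b = d -> is_state rho ->
     (forall p : nat, (0 < p)%N ->
        [/\ ((E_chi p rho)%:E <= E_c_PPT_exact rho)%E,
            (E_c_PPT_exact rho <= (E_kappa p rho)%:E)%E
          & E_kappa p rho <=
              E_chi p rho + log2 (1 / (1 - (1 - 2 / d%:R) ^+ p))]) /\
     [/\ cvgn (E_kappa_rate rho) /\
           E_c_PPT_exact rho = (E_kappa_reg rho)%:E,
         (fun p => (E_chi p rho)%:E) @ \oo --> E_c_PPT_exact rho
       & (fun p => (E_kappa p rho)%:E) @ \oo --> E_c_PPT_exact rho]) /\
  (exists K c : R, [/\ 0 < K, 0 < c < 1 &
     forall (a b : nat) (rho : 'M[R[i]]_(a * b)),
       minn a b = d -> is_state rho ->
       forall p : nat, (0 < p)%N ->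
         (`|(E_chi p rho)%:E - E_c_PPT_exact rho| <= (K * c ^+ p)%:E)%E /\
         (`|(E_kappa p rho)%:E - E_c_PPT_exact rho| <= (K * c ^+ p)%:E)%E]).
Proof.
have d2 : 2 <= d%:R :> R by rewrite ler_nat.
have d0 : 0 < d%:R :> R by apply: lt_le_trans d2.
(* K comes from [log2_inv_le] with r = 2/d. The ratio is 1 - 1/d because 1 - 2/d vanishes for d = 2,
   whereas c must be positive. *)
pose K : R := d%:R / 2 / ln 2; pose c : R := 1 - 1 / d%:R.
have K0 : 0 < K by rewrite !divr_gt0 ?ln2_gt0.
have c01 : 0 < c < 1.
  rewrite /c gtrBl divr_gt0 // andbT subr_gt0 ltr_pdivrMr // mul1r.
  by rewrite (lt_le_trans _ d2) // ltr1n.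
have gap p : log2 (1 / (1 - (1 - 2 / d%:R) ^+ p.+1)) <= K * c ^+ p.+1.
  have x0 : 0 <= 1 - 2 / d%:R :> R by rewrite subr_ge0 ler_pdivrMr // mul1r.
  have x1 : 1 - 2 / d%:R <= 1 :> R by rewrite gerBl divr_ge0 // ltW.
  have xc : 1 - 2 / d%:R <= c.
    by rewrite lerD2l lerN2 ler_pM2r ?invr_gt0 // ler1n.
  apply: le_trans (log2_inv_le (r := 2 / d%:R) _ _ _) _.
  - exact: exprn_ge0.
  - by rewrite divr_gt0.
  - by rewrite exprS ler_piMr // exprn_ile1.
  rewrite /K invf_div mulrA [K in _ <= K]mulrC mulrA ler_pM2r ?invr_gt0 ?ln2_gt0 //.
  rewrite -mulrA ler_pM2r ?divr_gt0 //.
  by rewrite lerXn2r // nnegrE // (le_trans x0).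
have main (a b : nat) (rho : 'M[R[i]]_(a * b)) : minn a b = d -> is_state rho ->
    exists2 l : R, E_c_PPT_exact rho = l%:E &
    forall p, [/\ E_chi p.+1 rho <= l, l <= E_kappa p.+1 rho,
      E_kappa p.+1 rho <= E_chi p.+1 rho + log2 (1 / (1 - (1 - 2 / d%:R) ^+ p.+1)),
      `|E_chi p.+1 rho - l| <= K * c ^+ p.+1 &
      `|E_kappa p.+1 rho - l| <= K * c ^+ p.+1].
  move=> dE st.
  have lo p := E_chi_le_cost p st; have up p := cost_le_E_kappa p st.
  case E : (E_c_PPT_exact rho) => [l| |]; last 2 first.
  - by have := up 0%N; rewrite E.
  - by have := lo 0%N; rewrite E.
  exists l => // p; have := lo p.+1; have := up p; rewrite E !lee_fin => h1 h2.
  have h3 := E_kappa_le_E_chi p dE hd st; have h4 := gap p.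
  split=> //.
    by rewrite distrC ger0_norm ?subr_ge0 //; move: h1 h2 h3 h4; lra.
  by rewrite ger0_norm ?subr_ge0 //; move: h1 h2 h3 h4; lra.
split; last first.
  exists K, c; split=> // a b rho dE st [//|p] _.
  have [l -> /(_ p) [_ _ _ h1 h2]] := main a b rho dE st.
  by rewrite -!EFinB !abse_EFin !lee_fin.
move=> a b rho dE st; have [l lE hl] := main a b rho dE st.
have gap0 : (fun p => K * c ^+ p) @ \oo --> (0 : R).
  apply: (@cvg_geometric R K c); case/andP: c01 => c0 c1.
  by rewrite ger0_norm // ltW.
have rate : E_kappa_rate rho @ \oo --> l.
  apply/cvgrPdist_le => e e0.
  have e2 : 0 < e / 2 by rewrite divr_gt0.
  (* The chain length [N.+1] is fixed first, in terms of e; only then is the block length taken so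
     large that log2 (N + 1) divided by it is at most e/2. *)
  move/cvgrPdist_le : gap0 => /(_ _ e2) [N _ /(_ N.+1 (leqnSn N))].
  rewrite /= sub0r normrN ger0_norm; last first.
    by rewrite mulr_ge0 ?(ltW K0) // exprn_ge0 //; case/andP: c01 => /ltW.
  have [h1 h2 _ h3 h4] := hl N => h5.
  have L0 : 0 <= log2 (N.+1%:R : R).
    by rewrite divr_ge0 ?(ltW (ln2_gt0 R)) // ln_ge0 // ler1n.
  exists (Num.truncn (log2 (N.+1%:R : R) / (e / 2))).+1 => // -[//|n] /= Mn.
  have r1 := E_chi_le_rate N.+1 n st; have r2 := rate_le_E_kappa N n st.
  have r3 : log2 N.+1%:R / n.+1%:R <= e / 2 :> R.
    rewrite ler_pdivrMr ?ltr0n // mulrC -ler_pdivrMr // ltW //.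
    by apply: lt_le_trans (truncnS_gt _) _; rewrite ler_nat.
  exact: dist_le_of_sandwich h3 h4 r1 r2 h5 r3.
split=> [[//|p] _|].
  have [h1 h2 h3 _ _] := hl p; by rewrite lE !lee_fin.
split.
- split; first by apply/cvg_ex; exists l.
  by rewrite lE /E_kappa_reg (cvg_lim _ rate).
- rewrite lE; apply: cvg_EFin; first exact: nearW.
  by apply: cvg_of_bound gap0 _ => -[//|p] _; have [] := hl p.
- rewrite lE; apply: cvg_EFin; first exact: nearW.
  by apply: cvg_of_bound gap0 _ => -[//|p] _; have [] := hl p.
Qed.
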